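(* Let $H$ be a Hilbert space, $K=3$ or $K=4$, and let $L_1,\dots,L_K$ be closed subspaces of $H$. Denote $L=\bigcap_{k\in[K]}L_k$ and $T=P(L_K)\cdots P(L_2)P(L_1)$. The following statements are equivalent: (i) $L_1^{\perp}+\dots+L_K^{\perp}$ is not closed in $H$; (ii) for every sequence $\{a_n\}\in c_0$ there exists a starting point $z\in H$ such that $|T^nz-P(L)z|\geq a_n$ for all $n\in\mathbb N$; (iii) there exist closed subspaces $\tilde L_k\subset L_k\cap L^{\perp}$, $k\in[K]$, a starting point $z_0\in H$ and a sequence of indices $k_1,k_2,\dots\in[K]$ containing each $k\in[K]$ infinitely often, such that the sequence of iterates defined by $z_n=P(\tilde L_{k_n})z_{n-1}$, $n\ge 1$, does not converge in norm.
   Context: $[K]=\{1,\dots,K\}$. For a closed subspace $X$ of $H$, $P(X)$ is the orthogonal projection of $H$ onto $X$, and $X^\perp$ is its orthogonal complement in $H$. $|x|$ denotes the norm of $x\in H$. $c_0$ is the space of real sequences converging to $0$. *)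

(* Defs.v *)
From HB Require Import structures.
From mathcomp Require Import all_boot all_order all_algebra.
From mathcomp Require Import sesquilinear complex.
From mathcomp Require Import all_classical all_reals all_analysis.

Set Implicit Arguments.
Unset Strict Implicit.
Unset Printing Implicit Defensive.

Import Order.TTheory GRing.Theory Num.Theory.
Import numFieldNormedType.Exports.

Local Open Scope classical_set_scope.
Local Open Scope ring_scope.

(* A Hilbert space is real or complex: its field of scalars is R or R[i]. *)
Inductive scalar_kind := RealScalars | ComplexScalars.

Definition scalars (R : realType) (s : scalar_kind) : numFieldType :=
  match s with
  | RealScalars => R
  | ComplexScalars => R[i]
  end.

Definition scalar_conj (R : realType) (s : scalar_kind) :
    scalars R s -> scalars R s :=
  match s return scalars R s -> scalars R s with
  | RealScalars => idfun
  | ComplexScalars => @conjc R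
  end.

(* Norms of vectors are elements of [scalars R s]; this embedding allows one
   to compare them with elements of R. *)
Definition of_real (R : realType) (s : scalar_kind) : R -> scalars R s :=
  match s return R -> scalars R s with
  | RealScalars => idfun
  | ComplexScalars => real_complex R
  end.

Definition closed_subspace (F : numFieldType) (H : normedModType F)
    (X : set H) : Prop :=
  [/\ closed X, X 0 & forall a x y, X x -> X y -> X (a *: x + y)].

Section Hilbert.
Context (R : realType) (s : scalar_kind).
Context (H : completeNormedModType (scalars R s)).
Context (dot : {dot H for @scalar_conj R s}).

Definition orthocomp (X : set H) : set H :=
  [set x | forall y, X y -> dot x y = 0].

(* When X is a closed subspace there is exactly one y in X with x - y
   orthogonal to X; [xget] selects it (its default value 0 is irrelevant). *)
Definition orth_proj (X : set H) (x : H) : H :=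
  xget 0 [set y | X y /\ orthocomp X (x - y)].

Definition sum_sets (K : nat) (X : 'I_K -> set H) : set H :=
  [set x | exists2 y : 'I_K -> H, forall k, X k (y k) & x = \sum_k y k].

(* P(X_(K-1)) ... P(X_1) P(X_0): the factor of index 0 is applied first. *)
Definition proj_product (K : nat) (X : 'I_K -> set H) (x : H) : H :=
  foldl (fun y k => orth_proj (X k) y) x (enum 'I_K).

(* [k n] is the index of the projection leading from z_n to z_(n+1). *)
Fixpoint proj_iterates (K : nat) (X : 'I_K -> set H) (k : nat -> 'I_K)
    (z0 : H) (n : nat) : H :=
  match n with
  | 0 => z0
  | m.+1 => orth_proj (X (k m)) (proj_iterates X k z0 m)
  end.

End Hilbert.

(* Main.v *)
(** Let M be the orthogonal complement of L, and call the family regular when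
    c |x| <= sum_k |x - P(L_k) x| on M for some c > 0. Each of the three statements is
    equivalent to the failure of regularity.

    If the family is regular, T is a strict contraction of M. Hence x = y - T y has a
    solution y in M for every x in M, and y - T y lies in the sum of the L_k^perp, which is
    therefore M. Moreover T^n converges to P(L) at a geometric rate. Finally, a random
    product on subspaces of the L_k /\ M tends to 0: for K <= 4, the stretch between the
    last occurrence of one letter and the next occurrence of another one is a word in the
    two remaining letters, and such a word moves a vector by at most the square root of its
    loss of squared norm, so that some iterate is almost fixed by all the projections.

    If the family is not regular, M contains almost common unit vectors of the L_k, even
    orthogonally to finitely many given vectors. A series of them with the right
    signs converges arbitrarily slowly to 0 under T; another one lies in M but not in the sum
    of the L_k^perp. Sequences of them also provide copies, up to arbitrarily small errors,
    of any configuration of closed subspaces of l^2 inside the L_k. The configuration to copy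
    consists of subspaces W, X, Y: the product X Y X is diagonal in an orthonormal basis
    x_i of X, the eigenvalues being well separated, so that its powers kill the basis
    vectors one after the other; and the compression of the projection to x_i^perp to W is
    1 - d_i <., q_i> q_i with unit vectors q_i of W. Powers of W (X Y X)^s W thus approximate
    the projection to q_i^perp as long as the previously killed neighbours have
    much smaller weights d_j. The q_i are chosen so that the vector of W is turned in many
    small steps, with small total loss, through the quarter circles from w_0 to w_1, from
    w_1 to w_2, ..., where w_0, w_1, ... is an orthonormal basis of W. *)

Require Import Defs.
From HB Require Import structures.
From mathcomp Require Import all_boot all_order all_algebra.
From mathcomp Require Import sesquilinear complex.
From mathcomp Require Import all_classical all_reals all_analysis.
From mathcomp Require Import ring lra zify.

Set Implicit Arguments.
Unset Strict Implicit.
Unset Printing Implicit Defensive.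

Import Order.TTheory GRing.Theory Num.Theory.
Import numFieldNormedType.Exports.

Local Open Scope classical_set_scope.
Local Open Scope ring_scope.

(** * Real and complex scalars *)

Section Scalars.
Context (R : realType) (s : scalar_kind).
Local Notation F := (scalars R s).
Local Notation ofr := (@of_real R s).
Local Notation conj := (@scalar_conj R s).

Definition re_part : F -> R :=
  match s return scalars R s -> R with
  | RealScalars => idfun
  | ComplexScalars => @complex.Re R
  end.

Lemma of_realD : {morph ofr : x y / x + y}.
Proof. by rewrite /of_real; case: s => x y //=; rewrite rmorphD. Qed.
Lemma of_realM : {morph ofr : x y / x * y}.
Proof. by rewrite /of_real; case: s => x y //=; rewrite rmorphM. Qed.
Lemma of_realN : {morph ofr : x / - x}.
Proof. by rewrite /of_real; case: s => x //=; rewrite rmorphN. Qed.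
Lemma of_realB : {morph ofr : x y / x - y}.
Proof. by move=> x y; rewrite of_realD of_realN. Qed.
Lemma of_real0 : ofr 0 = 0.
Proof. by rewrite /of_real; case: s. Qed.
Lemma of_real1 : ofr 1 = 1.
Proof. by rewrite /of_real; case: s. Qed.
Lemma of_realX n : {morph ofr : x / x ^+ n}.
Proof.
by move=> x; elim: n => [|n ih]; rewrite ?expr0 ?of_real1 // !exprS of_realM ih.
Qed.
Lemma of_real_sum I (r : seq I) (P : pred I) (f : I -> R) :
  ofr (\sum_(i <- r | P i) f i) = \sum_(i <- r | P i) ofr (f i).
Proof. exact: (big_morph _ of_realD of_real0). Qed.

Lemma ler_of_real x y : (ofr x <= ofr y) = (x <= y).
Proof. by rewrite /of_real; case: s => //=; rewrite lecR. Qed.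
Lemma ltr_of_real x y : (ofr x < ofr y) = (x < y).
Proof. by rewrite /of_real; case: s => //=; rewrite ltcR. Qed.
Lemma of_real_inj : injective ofr.
Proof.
by move=> x y xy; apply/eqP; rewrite eq_le -!ler_of_real xy lexx.
Qed.
Lemma of_real_norm x : `|ofr x| = ofr `|x|.
Proof. by rewrite /of_real; case: s => //=; rewrite normc_def /= expr0n addr0 sqrtr_sqr. Qed.

Lemma re_partD : {morph re_part : x y / x + y}.
Proof. by rewrite /re_part; case: s => x y //=; rewrite raddfD. Qed.
Lemma re_partN : {morph re_part : x / - x}.
Proof. by rewrite /re_part; case: s => x //=; rewrite raddfN. Qed.
Lemma re_part0 : re_part 0 = 0.
Proof. by rewrite /re_part; case: s. Qed.
Lemma of_realK : cancel ofr re_part.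
Proof. by rewrite /re_part /of_real; case: s. Qed.
Lemma re_partZ r x : re_part (ofr r * x) = r * re_part x.
Proof.
rewrite /re_part /of_real; case: s x => //= -[a b] /=; by rewrite mul0r subr0.
Qed.
Lemma re_part_conj x : re_part (conj x) = re_part x.
Proof. by rewrite /re_part /scalar_conj; case: s x => //= -[]. Qed.
Lemma ge0_re_partK (x : F) : 0 <= x -> ofr (re_part x) = x.
Proof.
rewrite /re_part /of_real; case: s x => //= -[a b].
by rewrite lecE /= => /andP[/eqP ->].
Qed.
Lemma scalar_conjM : {morph conj : x y / x * y}.
Proof. by rewrite /scalar_conj; case: s => x y //=; rewrite rmorphM. Qed.
Lemma scalar_conj0 : conj 0 = 0.
Proof. by rewrite /scalar_conj; case: s => //=; rewrite oppr0. Qed.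
Lemma scalar_conj_real r : conj (ofr r) = ofr r.
Proof. by rewrite /scalar_conj /of_real; case: s => //=; rewrite oppr0. Qed.

(** The absolute value as an element of [R]: complex scalars are only partially ordered, so
    estimates are moved to [R]. *)
Definition modulus (x : F) : R := re_part `|x|.
Lemma normE_modulus (x : F) : `|x| = ofr (modulus x).
Proof. by rewrite ge0_re_partK // normr_ge0. Qed.
Lemma modulus_ge0 x : 0 <= modulus x.
Proof. by rewrite -ler_of_real of_real0 -normE_modulus. Qed.
Lemma mul_conj x : x * conj x = ofr (modulus x ^+ 2).
Proof.
rewrite of_realX -normE_modulus.
rewrite /scalar_conj; case: s x => /= [x|[a b]] /=.
  by rewrite real_normK ?num_real // expr2.
rewrite normc_def /= -rmorphXn /= sqr_sqrtr ?addr_ge0 ?sqr_ge0 //.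
by simpc; congr (_ +i* _)%C; ring.
Qed.
Lemma re_part_le x : `|re_part x| <= modulus x.
Proof.
rewrite -ler_of_real -normE_modulus.
rewrite /re_part /of_real; case: s x => //= -[a b] /=.
rewrite normc_def lecR -sqrtr_sqr ler_sqrt ?lerDl ?sqr_ge0 //.
by rewrite addr_ge0 ?sqr_ge0.
Qed.
Lemma modulusM x y : modulus (x * y) = modulus x * modulus y.
Proof. by apply: of_real_inj; rewrite of_realM -!normE_modulus normrM. Qed.
Lemma modulus_real r : modulus (ofr r) = `|r|.
Proof. by apply: of_real_inj; rewrite -normE_modulus of_real_norm. Qed.
Lemma modulus_eq0 x : modulus x = 0 -> x = 0.
Proof.
by move=> h; apply/eqP; rewrite -normr_eq0 normE_modulus h of_real0.
Qed.
End Scalars.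

(** * Inner products and orthogonal projections *)

Section InnerProduct.
Context (R : realType) (s : scalar_kind).
Context (H : completeNormedModType (scalars R s)).
Context (dot : {dot H for @scalar_conj R s}).
Hypothesis norm_dot : forall x : H, `|x| ^+ 2 = dot x x.
Local Notation F := (scalars R s).
Local Notation ofr := (@of_real R s).
Local Notation conj := (@scalar_conj R s).
Implicit Types (x y z : H) (a b : F) (r t : R).

(** With [nrm] and [re_dot], H becomes a real inner product space, and all estimates take place in
    [R] for both kinds of scalars. *)
Definition nrm x : R := re_part `|x|.
Definition re_dot x y : R := re_part (dot x y).
Local Notation ip := re_dot.

Lemma normE_nrm x : `|x| = ofr (nrm x).
Proof. by rewrite ge0_re_partK // normr_ge0. Qed.
Lemma nrm_ge0 x : 0 <= nrm x.
Proof. by rewrite -(ler_of_real s) of_real0 -normE_nrm. Qed.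
Lemma nrm0 : nrm 0 = 0.
Proof. by rewrite /nrm normr0 re_part0. Qed.
Lemma nrm_eq0 x : nrm x = 0 -> x = 0.
Proof. by move=> h; apply/eqP; rewrite -normr_eq0 normE_nrm h of_real0. Qed.
Lemma nrmN x : nrm (- x) = nrm x.
Proof. by rewrite /nrm normrN. Qed.
Lemma nrmD x y : nrm (x + y) <= nrm x + nrm y.
Proof. by rewrite -(ler_of_real s) of_realD -!normE_nrm ler_normD. Qed.
Lemma nrmB x y : nrm (x - y) = nrm (y - x).
Proof. by rewrite -nrmN opprB. Qed.
Lemma nrm_tri y x z : nrm (x - z) <= nrm (x - y) + nrm (y - z).
Proof. by apply: le_trans (nrmD _ _); rewrite addrA subrK. Qed.
Lemma nrmZ a x : nrm (a *: x) = modulus a * nrm x.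
Proof.
by apply: (@of_real_inj _ s); rewrite of_realM -normE_modulus -!normE_nrm normrZ.
Qed.
Lemma nrmZr r x : nrm (ofr r *: x) = `|r| * nrm x.
Proof. by rewrite nrmZ modulus_real. Qed.
Lemma nrm_sum I (l : seq I) (P : pred I) (f : I -> H) :
  nrm (\sum_(i <- l | P i) f i) <= \sum_(i <- l | P i) nrm (f i).
Proof.
elim/big_ind2: _ => [|x a y b|i _] //; first by rewrite nrm0.
by move=> hx hy; apply: le_trans (nrmD _ _) _; rewrite lerD.
Qed.
Lemma nrm_sub_le x y : nrm x - nrm y <= nrm (x - y).
Proof. by rewrite lerBlDr; apply: le_trans (nrmD _ _); rewrite subrK. Qed.

Lemma dotC x y : dot y x = conj (dot x y).
Proof.
by move: (dot) => [? [? ? [h]]] /=; have := h y x; rewrite expr0 mul1r.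
Qed.
Lemma dotDl x y z : dot (x + y) z = dot x z + dot y z.
Proof. exact: linearDl. Qed.
Lemma dotDr x y z : dot x (y + z) = dot x y + dot x z.
Proof. exact: linearDr. Qed.
Lemma dotNr x y : dot x (- y) = - dot x y.
Proof. exact: linearNr. Qed.
Lemma dotBl x y z : dot (x - y) z = dot x z - dot y z.
Proof. exact: linearBl. Qed.
Lemma dotBr x y z : dot x (y - z) = dot x y - dot x z.
Proof. exact: linearBr. Qed.
Lemma dot0l x : dot 0 x = 0.
Proof. exact: linear0l. Qed.
Lemma dot0r x : dot x 0 = 0.
Proof. exact: linear0r. Qed.
Lemma dotZl a x y : dot (a *: x) y = a * dot x y.
Proof. by rewrite linearZl_LR. Qed.
Lemma dotZr a x y : dot x (a *: y) = conj a * dot x y.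
Proof. by rewrite linearZr_LR. Qed.
Lemma dot_suml I (l : seq I) (P : pred I) (f : I -> H) y :
  dot (\sum_(i <- l | P i) f i) y = \sum_(i <- l | P i) dot (f i) y.
Proof. exact: linear_sumlz. Qed.
Lemma dot_sumr I (l : seq I) (P : pred I) (f : I -> H) y :
  dot y (\sum_(i <- l | P i) f i) = \sum_(i <- l | P i) dot y (f i).
Proof. exact: linear_sumr. Qed.
Lemma dotxx x : dot x x = ofr (nrm x ^+ 2).
Proof. by rewrite -norm_dot normE_nrm of_realX. Qed.
Lemma dot_eq0C x y : dot x y = 0 -> dot y x = 0.
Proof. by move=> h; rewrite dotC h scalar_conj0. Qed.

Lemma ipC x y : ip x y = ip y x.
Proof. by rewrite /re_dot dotC re_part_conj. Qed.
Lemma ipDl x y z : ip (x + y) z = ip x z + ip y z.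
Proof. by rewrite /re_dot dotDl re_partD. Qed.
Lemma ipDr x y z : ip x (y + z) = ip x y + ip x z.
Proof. by rewrite /re_dot dotDr re_partD. Qed.
Lemma ipNr x y : ip x (- y) = - ip x y.
Proof. by rewrite /re_dot dotNr re_partN. Qed.
Lemma ipZl r x y : ip (ofr r *: x) y = r * ip x y.
Proof. by rewrite /re_dot dotZl re_partZ. Qed.
Lemma ipZr r x y : ip x (ofr r *: y) = r * ip x y.
Proof. by rewrite ipC ipZl ipC. Qed.
Lemma ip_sumr I (l : seq I) (p : pred I) (f : I -> H) x :
  ip x (\sum_(i <- l | p i) f i) = \sum_(i <- l | p i) ip x (f i).
Proof.
by rewrite /re_dot dot_sumr (big_morph (@re_part R s) (@re_partD _ _) (@re_part0 _ _)).
Qed.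
Lemma ipxx x : ip x x = nrm x ^+ 2.
Proof. by rewrite /re_dot dotxx of_realK. Qed.
Lemma dot_ip0 x y : dot x y = 0 -> ip x y = 0.
Proof. by rewrite /re_dot => ->; rewrite re_part0. Qed.

Lemma nrm_sqD x y : nrm (x + y) ^+ 2 = nrm x ^+ 2 + 2 * ip x y + nrm y ^+ 2.
Proof. by rewrite -!ipxx ipDl !ipDr (ipC y x); ring. Qed.
Lemma nrm_sqB x y : nrm (x - y) ^+ 2 = nrm x ^+ 2 - 2 * ip x y + nrm y ^+ 2.
Proof. by rewrite nrm_sqD ipNr nrmN; ring. Qed.
Lemma nrm_le_sq x r : 0 <= r -> nrm x ^+ 2 <= r ^+ 2 -> nrm x <= r.
Proof. by move=> r0; rewrite ler_pXn2r // nnegrE ?nrm_ge0. Qed.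

Lemma cauchy_schwarz x y : modulus (dot x y) <= nrm x * nrm y.
Proof.
have [y0|y0] := eqVneq (nrm y) 0.
  rewrite (nrm_eq0 y0) dot0r nrm0 mulr0 -(of_real0 R s) modulus_real normr0 //.
have yp : 0 < nrm y by rewrite lt_def y0 nrm_ge0.
set n := nrm y; set a := dot x y.
(* The squared norm of |y|^2 x - <x,y> y; scaling x by |y|^2 replaces a division by |y|^2. *)
have E : dot (ofr (n ^+ 2) *: x - a *: y) (ofr (n ^+ 2) *: x - a *: y) =
         ofr (n ^+ 2 * (n ^+ 2 * nrm x ^+ 2 - modulus a ^+ 2)).
  rewrite !(dotBl, dotBr, dotZl, dotZr) scalar_conj_real (dotC x y) !dotxx.
  rewrite -/a -/n of_realM of_realB of_realM -mul_conj.
  by set b := conj a; ring.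
have : 0 <= n ^+ 2 * (n ^+ 2 * nrm x ^+ 2 - modulus a ^+ 2).
  by rewrite -(ler_of_real s) -E dotxx of_real0 -(of_real0 R s) ler_of_real sqr_ge0.
rewrite pmulr_rge0 ?exprn_gt0 // subr_ge0 -exprMn mulrC => h.
by rewrite -(@ler_pXn2r _ 2) // nnegrE ?modulus_ge0 ?mulr_ge0 ?nrm_ge0.
Qed.
Lemma ip_le x y : `|ip x y| <= nrm x * nrm y.
Proof. exact: le_trans (re_part_le _) (cauchy_schwarz _ _). Qed.

Lemma closed_nrmP (X : set H) :
  closed X <-> forall x, (forall e, 0 < e -> exists2 y, X y & nrm (x - y) < e) -> X x.
Proof.
split=> [cX x hx|h].
  rewrite (closure_id X).1 // => B /nbhs_ballP [e /= e0 eB].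
  have e1 : 0 < re_part e.
    by rewrite -(ltr_of_real s) of_real0 ge0_re_partK // ltW.
  have [y Xy xy] := hx _ e1; exists y; split=> //; apply: eB.
  rewrite -ball_normE /= normE_nrm.
  by rewrite -(ge0_re_partK (ltW e0)) ltr_of_real.
apply/closure_id; apply/seteqP; split; first exact: subset_closure.
move=> x clx; apply: h => e e0.
have [|y [Xy /= By]] := clx (ball x (ofr e)).
  by apply: nbhsx_ballx; rewrite -(of_real0 R s) ltr_of_real.
exists y => //; move: By.
by rewrite -ball_normE /= normE_nrm ltr_of_real.
Qed.

Lemma complete_nrm (u : nat -> H) :
  (forall e, 0 < e -> exists N, forall m n, (N <= m)%N -> (N <= n)%N ->
     nrm (u m - u n) < e) ->
  exists l, forall e, 0 < e -> exists N, forall n, (N <= n)%N -> nrm (u n - l) < e.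
Proof.
move=> hu.
have cu : cauchy (u @ \oo).
  apply/cauchy_exP => e e0.
  have e1 : 0 < re_part e.
    by rewrite -(ltr_of_real s) of_real0 ge0_re_partK // ltW.
  have [N hN] := hu _ e1; exists (u N).
  exists N => // n /= Nn.
  rewrite -ball_normE /= normE_nrm -(ge0_re_partK (ltW e0)) ltr_of_real.
  exact: hN.
have /cauchy_cvgP/cvg_ex [l ul] := cu.
exists l => e e0.
have e1 : 0 < ofr e by rewrite -(of_real0 R s) ltr_of_real.
have /cvgrPdist_lt/(_ _ e1) [N _ hN] := ul.
exists N => n Nn; move: (hN n Nn); rewrite /= normE_nrm ltr_of_real.
by rewrite nrmB.
Qed.

Lemma cvgn_cauchy_nrm (u : nat -> H) : cvgn u ->
  forall e, 0 < e -> exists N, forall m n, (N <= m)%N -> (N <= n)%N ->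
     nrm (u m - u n) < e.
Proof.
move=> /cvg_ex [l ul] e e0.
have e1 : 0 < ofr (e / 2) by rewrite -(of_real0 R s) ltr_of_real divr_gt0.
have /cvgrPdist_lt/(_ _ e1) [N _ hN] := ul.
exists N => m n Nm Nn.
have := hN m Nm; have := hN n Nn; rewrite /= !normE_nrm !ltr_of_real => h1 h2.
by apply: le_lt_trans (nrm_tri l _ _) _; rewrite (nrmB (u m)) [ltRHS]splitr ltrD.
Qed.

Lemma nrm_cvg0 (u : nat -> H) :
  (forall e, 0 < e -> exists N, forall n, (N <= n)%N -> nrm (u n) < e) -> cvgn u.
Proof.
move=> h; apply/cvg_ex; exists 0; apply/cvgrPdist_lt => e e0.
have e1 : 0 < re_part e.
  by rewrite -(ltr_of_real s) of_real0 ge0_re_partK // ltW.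
have [N hN] := h _ e1; exists N => // n Nn /=.
by rewrite sub0r normrN normE_nrm -(ge0_re_partK (ltW e0)) ltr_of_real; exact: hN.
Qed.

Section Subspace.
Variable (X : set H).
Hypothesis cX : closed_subspace X.

Lemma subspace0 : X 0.
Proof. by case: cX. Qed.
Lemma subspaceZ a x : X x -> X (a *: x).
Proof. by case: cX => _ X0 h Xx; rewrite -[_ *: _]addr0; exact: h. Qed.
Lemma subspaceD x y : X x -> X y -> X (x + y).
Proof. by case: cX => _ X0 h Xx Xy; rewrite -[x]scale1r; exact: h. Qed.
Lemma subspaceN x : X x -> X (- x).
Proof. by move=> Xx; rewrite -scaleN1r; exact: subspaceZ. Qed.
Lemma subspaceB x y : X x -> X y -> X (x - y).
Proof. by move=> Xx Xy; apply: subspaceD => //; exact: subspaceN. Qed.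
Lemma subspace_sum I (l : seq I) (P : pred I) (f : I -> H) :
  (forall i, P i -> X (f i)) -> X (\sum_(i <- l | P i) f i).
Proof.
move=> h; apply: big_ind => //; [exact: subspace0|exact: subspaceD].
Qed.
Lemma subspace_lim (u : nat -> H) x :
  (forall n, X (u n)) ->
  (forall e, 0 < e -> exists N, forall n, (N <= n)%N -> nrm (u n - x) < e) -> X x.
Proof.
move=> Xu ux; case: cX => /closed_nrmP h _ _; apply: h => e /ux [N hN].
by exists (u N) => //; rewrite nrmB; exact: hN.
Qed.
End Subspace.

Local Notation orthocomp := (orthocomp dot).
Local Notation P := (orth_proj dot).

Lemma orthocomp_closed (X : set H) : closed_subspace (orthocomp X).
Proof.
split.
- apply/closed_nrmP => x hx y Xy; apply: modulus_eq0.
  apply/eqP; rewrite eq_le modulus_ge0 andbT; apply/ler_addgt0Pr => e e0.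
  have d0 : 0 < nrm y + 1 by rewrite ltr_wpDl ?nrm_ge0.
  have [z hz xz] := hx (e / (nrm y + 1)) (divr_gt0 e0 d0).
  have -> : dot x y = dot (x - z) y by rewrite dotBl (hz y Xy) subr0.
  rewrite add0r; apply: le_trans (cauchy_schwarz _ _) _.
  have : nrm (x - z) * nrm y <= (e / (nrm y + 1)) * (nrm y + 1).
    by rewrite ler_pM ?nrm_ge0 // ?ltW // ltrDl.
  by rewrite divfK ?gt_eqF.
- by move=> y _; rewrite dot0l.
- by move=> a x y hx hy z Xz; rewrite dotDl dotZl hx // hy // mulr0 addr0.
Qed.

Lemma orthocompS (X Y : set H) : X `<=` Y -> orthocomp Y `<=` orthocomp X.
Proof. by move=> XY x hx y Xy; exact/hx/XY. Qed.
Lemma sub_orthocomp2 (X : set H) : X `<=` orthocomp (orthocomp X).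
Proof. by move=> x Xx y hy; apply: dot_eq0C; exact: hy. Qed.

Lemma closed_subspaceI (X Y : set H) :
  closed_subspace X -> closed_subspace Y -> closed_subspace (X `&` Y).
Proof.
move=> [cX X0 hX] [cY Y0 hY]; split; [exact: closedI|by []|].
by move=> a x y [Xx Yx] [Xy Yy]; split; [exact: hX|exact: hY].
Qed.
Lemma closed_subspace_bigcap I (X : I -> set H) :
  (forall i, closed_subspace (X i)) -> closed_subspace (\bigcap_i X i).
Proof.
move=> h; split.
- by apply: closed_bigI => i _; case: (h i).
- by move=> i _; case: (h i).
- by move=> a x y hx hy i _; case: (h i) => _ _; apply; [exact: hx|exact: hy].
Qed.

End InnerProduct.

(** * Existence and calculus of the orthogonal projection onto a closed subspace *)

Section Projection.
Context (R : realType) (s : scalar_kind).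
Context (H : completeNormedModType (scalars R s)).
Context (dot : {dot H for @scalar_conj R s}).
Hypothesis norm_dot : forall x : H, `|x| ^+ 2 = dot x x.
Local Notation F := (scalars R s).
Local Notation ofr := (@of_real R s).
Local Notation conj := (@scalar_conj R s).
Local Notation orthocomp := (orthocomp dot).
Local Notation P := (orth_proj dot).
Local Notation ip := (re_dot dot).
Implicit Types (x y z : H) (a b : F) (r t : R).

Variable (X : set H).
Hypothesis cX : closed_subspace X.

(** A minimising sequence for the distance from x to X is Cauchy by the parallelogram law. Its limit
    y is a nearest point, and moving y inside X along any z shows that x - y is orthogonal to z. *)
Lemma orth_proj_ex x : exists y, X y /\ orthocomp X (x - y).
Proof.
pose E := [set nrm (x - y) | y in X].
have E0 : has_inf E.
  split; first by exists (nrm (x - 0)), 0 => //; exact: subspace0 cX.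
  by exists 0 => _ [y _ <-]; exact: nrm_ge0.
set d := inf E.
have d0 : 0 <= d by apply: lb_le_inf; [case: E0|move=> _ [y _ <-]; exact: nrm_ge0].
have dle y : X y -> d <= nrm (x - y) by move=> Xy; apply: ge_inf; [case: E0|exists y].
have near e : 0 < e -> exists2 y, X y & nrm (x - y) < d + e.
  move=> e0; have [_ [y Xy <-] h] := inf_adherent e0 E0.
  by exists y.
have /choice [u hu] : forall n : nat, exists y, X y /\ nrm (x - y) < d + n.+1%:R^-1.
  by move=> n; have [|y] := near n.+1%:R^-1; [rewrite invr_gt0|exists y].
(* Parallelogram law: the midpoint of [u m] and [u n] lies in X, hence at distance at least d from
   x. *)
have half (m n : nat) : nrm (u m - u n) ^+ 2 <=
    2 * nrm (x - u m) ^+ 2 + 2 * nrm (x - u n) ^+ 2 - 4 * d ^+ 2.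
  have -> : u m - u n = (x - u n) - (x - u m) by rewrite opprB [RHS]addrC subrKA.
  have h : d <= nrm (ofr 2^-1 *: ((x - u n) + (x - u m))).
    have -> : ofr 2^-1 *: ((x - u n) + (x - u m)) = x - ofr 2^-1 *: (u n + u m).
      rewrite addrACA -opprD scalerBr; congr (_ - _).
      rewrite -[x in x + _]scale1r -[x in _ + x]scale1r -scalerDl scalerA.
      by rewrite -(of_real1 R s) -of_realD -of_realM mulVf ?of_real1 ?scale1r.
    apply: dle; apply: subspaceZ => //; apply: subspaceD => //;
    by case: (hu m) (hu n) => ? _ [].
  have : (2 * d) ^+ 2 <= nrm ((x - u n) + (x - u m)) ^+ 2.
    rewrite ler_pXn2r ?nnegrE ?nrm_ge0 ?mulr_ge0 //.
    by move: h; rewrite nrmZr ger0_norm ?invr_ge0 //; lra.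
  rewrite (nrm_sqD norm_dot (x - u n)) (nrm_sqB norm_dot (x - u n)); lra.
have cu e : 0 < e -> exists N, forall m n, (N <= m)%N -> (N <= n)%N ->
    nrm (u m - u n) < e.
  (* For mu = min(eta, 1), 4 (d + mu)^2 - 4 d^2 <= mu (8 d + 8) <= e^2. *)
  move=> e0; pose eta := e ^+ 2 / (8 * d + 8).
  have dp : 0 < 8 * d + 8 by lra.
  have eta0 : 0 < eta by rewrite divr_gt0 ?exprn_gt0.
  have [N hN] : exists N : nat, N.+1%:R^-1 < Num.min eta 1.
    have m0 : 0 < Num.min eta 1 by rewrite lt_min eta0 ltr01.
    exists (Num.truncn (Num.min eta 1)^-1).
    by rewrite invf_plt ?posrE // truncnS_gt.
  exists N => m n Nm Nn.
  have bound k : (N <= k)%N -> nrm (x - u k) < d + Num.min eta 1.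
    move=> Nk; have [_ h] := hu k; apply: lt_le_trans h _.
    rewrite lerD2l; apply/ltW; apply: le_lt_trans hN.
    by rewrite lef_pV2 ?posrE // ler_nat.
  set mu := Num.min eta 1 in bound; have mu0 : 0 < mu by rewrite lt_min eta0 ltr01.
  have mu1 : mu <= 1 by rewrite ge_min lexx orbT.
  have mue : mu * (8 * d + 8) <= e ^+ 2.
    by rewrite -ler_pdivlMr // ge_min lexx.
  have sq k : (N <= k)%N -> nrm (x - u k) ^+ 2 < (d + mu) ^+ 2.
    by move=> Nk; rewrite ltr_pXn2r ?nnegrE ?nrm_ge0 ?addr_ge0 ?bound // ltW.
  rewrite -(@ltr_pXn2r _ 2) ?nnegrE ?nrm_ge0 ?(ltW e0) //.
  apply: le_lt_trans (half m n) _.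
  have := sq m Nm; have := sq n Nn; nra.
have [y hy] := complete_nrm cu.
have Xy : X y by apply: (subspace_lim cX _ hy) => n; case: (hu n).
have ymin w : X w -> nrm (x - y) <= nrm (x - w).
  move=> Xw; apply/ler_addgt0Pr => e e0.
  have [N hN] := hy (e / 2) (divr_gt0 e0 (ltr0n _ 2)).
  pose M := Num.truncn (e / 2)^-1.
  have hM : M.+1%:R^-1 < e / 2 by rewrite invf_plt ?posrE ?truncnS_gt ?divr_gt0.
  pose k := maxn N M.
  have h1 := hN k (leq_maxl _ _).
  have [_ h2] := hu k.
  have h3 : k.+1%:R^-1 <= M.+1%:R^-1 :> R by rewrite lef_pV2 ?posrE // ler_nat ltnS leq_maxr.
  have h4 := nrm_tri (u k) x y; have h5 := dle w Xw.
  apply: le_trans h4 _; apply: le_trans (lerD (ltW h2) (ltW h1)) _.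
  rewrite [e in leRHS]splitr addrA lerD2r lerD //.
  exact: le_trans h3 (ltW hM).
exists y; split=> // z Xz.
have [->|z0] := eqVneq z 0; first by rewrite dot0r.
have zp : 0 < nrm z.
  by rewrite lt_def nrm_ge0 andbT; apply: contra z0 => /eqP/nrm_eq0 ->.
(* [t * c] is the coefficient of the projection of v onto the line of z; subtracting it lowers the
   squared distance by |c|^2 / |z|^2, so minimality forces c = 0. *)
set v := x - y; set c := dot v z; set t := (nrm z ^+ 2)^-1.
have h : nrm v ^+ 2 <= nrm (v - (ofr t * c) *: z) ^+ 2.
  rewrite ler_pXn2r ?nnegrE ?nrm_ge0 //.
  have -> : v - (ofr t * c) *: z = x - (y + (ofr t * c) *: z) by rewrite opprD addrA.
  by apply: ymin; apply: subspaceD => //; exact: subspaceZ.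
move: h; rewrite (nrm_sqB norm_dot) nrmZ modulusM modulus_real.
have -> : ip v ((ofr t * c) *: z) = t * modulus c ^+ 2.
  rewrite /re_dot dotZr. rewrite scalar_conjM scalar_conj_real -mulrA re_partZ -/c.
  by rewrite [conj c * c]mulrC mul_conj of_realK.
move=> h; apply: modulus_eq0; apply/eqP; rewrite -[_ == _](@expf_eq0 _ _ 2).
have tp : 0 < t by rewrite invr_gt0 exprn_gt0.
rewrite ger0_norm ?(ltW tp) // in h.
have e1 : (t * modulus c * nrm z) ^+ 2 = t * modulus c ^+ 2.
  have tn : t * nrm z ^+ 2 = 1 by rewrite mulVf // expf_neq0 // gt_eqF.
  by rewrite -[RHS]mul1r -tn; ring.
rewrite e1 in h.
have h' : t * modulus c ^+ 2 <= 0 by lra.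
by rewrite eq_le sqr_ge0 andbT -(pmulr_rle0 _ tp).
Qed.

Lemma orth_projP x : X (P X x) /\ orthocomp X (x - P X x).
Proof.
rewrite /orth_proj.
have [y hy] := orth_proj_ex x.
by case: xgetP => [z _ //|h]; case: (h y hy).
Qed.
Lemma orth_proj_in x : X (P X x).
Proof. by case: (orth_projP x). Qed.
Lemma orth_proj_orth x y : X y -> dot (x - P X x) y = 0.
Proof. by case: (orth_projP x) => _; apply. Qed.
Lemma orth_proj_uniq x y : X y -> orthocomp X (x - y) -> P X x = y.
Proof.
move=> Xy hy; have [Xp hp] := orth_projP x.
apply/eqP; rewrite -subr_eq0; apply/eqP/nrm_eq0/eqP.
rewrite -[_ == _](@expf_eq0 _ _ 2) -(ipxx norm_dot); apply/eqP.
have Xd : X (P X x - y) by exact: subspaceB.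
have e : P X x - y = (x - y) - (x - P X x) by rewrite opprB [RHS]addrC subrKA.
by apply: dot_ip0; rewrite {1}e dotBl hy // hp // subr0.
Qed.
Lemma orth_proj_lin a x y : P X (a *: x + y) = a *: P X x + P X y.
Proof.
have [Xx hx] := orth_projP x; have [Xy hy] := orth_projP y.
apply: orth_proj_uniq; first by apply: subspaceD => //; exact: subspaceZ.
move=> z Xz; rewrite opprD addrACA -scalerBr dotDl dotZl hx // hy //.
by rewrite mulr0 addr0.
Qed.
Lemma orth_proj_id x : X x -> P X x = x.
Proof. by move=> Xx; apply: orth_proj_uniq => // z _; rewrite subrr dot0l. Qed.
Lemma orth_proj_eq0 x : orthocomp X x -> P X x = 0.
Proof. by move=> hx; apply: orth_proj_uniq; [exact: subspace0|rewrite subr0]. Qed.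
Lemma orth_projD x y : P X (x + y) = P X x + P X y.
Proof. by rewrite -[x in LHS]scale1r orth_proj_lin scale1r. Qed.
Lemma orth_proj0 : P X 0 = 0.
Proof. by apply: orth_proj_id; exact: subspace0. Qed.
Lemma orth_projZ a x : P X (a *: x) = a *: P X x.
Proof. by rewrite -[_ *: x]addr0 orth_proj_lin orth_proj0 addr0. Qed.
Lemma orth_projN x : P X (- x) = - P X x.
Proof. by rewrite -scaleN1r orth_projZ scaleN1r. Qed.
Lemma orth_projB x y : P X (x - y) = P X x - P X y.
Proof. by rewrite orth_projD orth_projN. Qed.
Lemma dot_proj x y : dot (P X x) y = dot x (P X y).
Proof.
rewrite -[y in LHS](subrK (P X y)) -[x in RHS](subrK (P X x)) dotDl dotDr.
rewrite (orth_proj_orth x) ?(dot_eq0C (orth_proj_orth y _)) ?add0r //;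
  exact: orth_proj_in.
Qed.
Lemma ip_proj x y : ip (P X x) y = ip x (P X y).
Proof. by rewrite /re_dot dot_proj. Qed.
Lemma nrm_proj_sq x : nrm x ^+ 2 = nrm (P X x) ^+ 2 + nrm (x - P X x) ^+ 2.
Proof.
rewrite -[x in LHS](subrK (P X x)) (nrm_sqD norm_dot (x - P X x)).
rewrite (dot_ip0 (orth_proj_orth _ (orth_proj_in _))); ring.
Qed.
Lemma nrm_proj_le x : nrm (P X x) <= nrm x.
Proof.
by apply: nrm_le_sq; rewrite ?nrm_ge0 // (nrm_proj_sq x) lerDl sqr_ge0.
Qed.
Lemma proj_nonexp x y : nrm (P X x - P X y) <= nrm (x - y).
Proof. by rewrite -orth_projB nrm_proj_le. Qed.
Lemma proj_best x y : X y -> nrm (x - P X x) <= nrm (x - y).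
Proof.
move=> Xy; apply: nrm_le_sq; first exact: nrm_ge0.
rewrite -[x - y](subrKA (P X x)) (nrm_sqD norm_dot (x - P X x)) dot_ip0 ?mulr0 ?addr0 ?lerDl ?sqr_ge0 //.
by apply: orth_proj_orth; apply: subspaceB => //; exact: orth_proj_in.
Qed.
(** The vector x - P x is orthogonal to x and to P x, hence to itself. *)
Lemma orthocomp2 : orthocomp (orthocomp X) `<=` X.
Proof.
move=> x hx; have [Xp hp] := orth_projP x.
suff -> : x = P X x by [].
apply/eqP; rewrite -subr_eq0; apply/eqP/nrm_eq0/eqP.
rewrite -[_ == _](@expf_eq0 _ _ 2) -(ipxx norm_dot); apply/eqP/dot_ip0.
by rewrite {1}dotBl hx // (dot_eq0C (hp _ Xp)) subr0.
Qed.
End Projection.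

(** * Regular families and products of projections *)

Lemma geometric_small (R : realType) (q C e : R) : 0 <= q < 1 -> 0 < e ->
  exists N, forall n, (N <= n)%N -> q ^+ n * C < e.
Proof.
move=> /andP[q0 q1] e0.
have d0 : 0 < `|C| + 1 by rewrite ltr_wpDl.
have /cvg_expr/cvgrPdist_lt/(_ _ (divr_gt0 e0 d0)) [N _ hN] : `|q| < 1 by rewrite ger0_norm.
exists N => n Nn; have := hN n Nn; rewrite /= sub0r normrN ger0_norm ?exprn_ge0 //.
rewrite ltr_pdivlMr // => h; apply: le_lt_trans h.
by rewrite ler_wpM2l ?exprn_ge0 // (le_trans (ler_norm _)) // lerDl.
Qed.

Section GeometricLimit.
Context (R : realType) (s : scalar_kind).
Context (H : completeNormedModType (scalars R s)).

(** Summing the geometric tail makes u Cauchy with an explicit rate; keeping 1 - q on the left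
    avoids a division. *)
Lemma geometric_limit (u : nat -> H) (C q : R) : 0 < q < 1 ->
  (forall n, nrm (u n.+1 - u n) <= C * q ^+ n) ->
  exists l, forall n, nrm (u n - l) * (1 - q) <= C * q ^+ n.
Proof.
move=> /andP[q0 q1] hu.
have p1 : 0 < 1 - q by rewrite subr_gt0.
have C0 : 0 <= C by have := hu 0%N; rewrite expr0 mulr1; apply/le_trans/nrm_ge0.
have ubound n m : nrm (u (n + m)%N - u n) * (1 - q) <= (q ^+ n - q ^+ (n + m)) * C.
  elim: m => [|m ih]; first by rewrite addn0 !subrr nrm0 !mul0r.
  rewrite addnS exprS; have := hu (n + m)%N.
  have := nrm_tri (u (n + m)%N) (u (n + m).+1) (u n); move: ih; nra.
have ubound2 n m : (n <= m)%N -> nrm (u n - u m) * (1 - q) <= C * q ^+ n.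
  move=> nm; have := ubound n (m - n)%N; rewrite subnKC // nrmB => h.
  apply: le_trans h _.
  by rewrite mulrC ler_wpM2l // lerBlDr lerDl exprn_ge0 // ltW.
have qq : 0 <= q < 1 by rewrite (ltW q0).
have [e e0|l hl] := @complete_nrm _ _ _ u.
  have [N hN] := geometric_small C qq (mulr_gt0 e0 p1).
  exists N => m n Nm Nn; rewrite -(ltr_pM2r p1).
  have hN' k : (N <= k)%N -> C * q ^+ k < e * (1 - q) by rewrite mulrC; exact: hN.
  case: (leqP m n) => [mn|/ltnW mn]; first exact: le_lt_trans (ubound2 _ _ mn) (hN' m Nm).
  by rewrite nrmB; exact: le_lt_trans (ubound2 _ _ mn) (hN' n Nn).
exists l => n; apply/ler_addgt0Pr => e e0.
have [N hN] := hl _ e0.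
have := hN (maxn N n) (leq_maxl _ _).
have := ubound2 n (maxn N n) (leq_maxr _ _).
have := nrm_tri (u (maxn N n)) (u n) l; have := nrm_ge0 (u (maxn N n) - l); nra.
Qed.

Lemma geometric_limitP (u : nat -> H) (C q : R) l : 0 < q < 1 ->
  (forall n, nrm (u n - l) * (1 - q) <= C * q ^+ n) ->
  forall e, 0 < e -> exists N, forall n, (N <= n)%N -> nrm (u n - l) < e.
Proof.
move=> /andP[q0 q1] hu e e0.
have p1 : 0 < 1 - q by rewrite subr_gt0.
have qq : 0 <= q < 1 by rewrite (ltW q0).
have [N hN] := geometric_small C qq (mulr_gt0 e0 p1).
exists N => n Nn; rewrite -(ltr_pM2r p1); apply: le_lt_trans (hu n) _.
by rewrite mulrC hN.
Qed.
End GeometricLimit.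

(** * Regularity, contraction by T, and the sum of the orthogonal complements *)

Section Family.
Context (R : realType) (s : scalar_kind).
Context (H : completeNormedModType (scalars R s)).
Context (dot : {dot H for @scalar_conj R s}).
Hypothesis norm_dot : forall x : H, `|x| ^+ 2 = dot x x.
Local Notation F := (scalars R s).
Local Notation orthocomp := (orthocomp dot).
Local Notation P := (orth_proj dot).
Implicit Types (x y z : H) (a b : F) (r t : R).

Context (K : nat) (Lk : 'I_K -> set H).
Hypothesis cL : forall k, closed_subspace (Lk k).
Local Notation L := (\bigcap_k Lk k).
Local Notation M := (orthocomp L).
Local Notation T := (proj_product dot Lk).
Local Notation Q := (foldl (fun y k => P (Lk k) y)).
Local Notation perp_sum := (sum_sets (fun k => orthocomp (Lk k))).

Definition proj_defect (k : 'I_K) x := nrm (x - P (Lk k) x).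
Local Notation defect := proj_defect.

(** Linear regularity: on M, where |x| is the distance to L, this distance is controlled by the
    distances to the single spaces. The set X is a parameter since subspaces of M of finite
    codimension are considered too. *)
Definition regular (X : set H) := exists2 c : R, 0 < c &
  forall x, X x -> c * nrm x <= \sum_k defect k x.

Lemma closed_subspace_cap : closed_subspace L.
Proof. exact: closed_subspace_bigcap. Qed.
Lemma closed_subspace_M : closed_subspace M.
Proof. exact: (orthocomp_closed norm_dot). Qed.

Lemma proj_orth_cap k x : M x -> M (P (Lk k) x).
Proof.
move=> Mx y Ly; rewrite (dot_proj norm_dot (cL k)).
by rewrite (orth_proj_id norm_dot (cL k)) ?Mx //; exact: Ly.
Qed.

Lemma defect_le k x y : Lk k y -> defect k x <= nrm (x - y).
Proof. exact: (proj_best norm_dot (cL k)). Qed.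

Lemma defect_tri k x y : defect k x <= nrm (x - y) + defect k y.
Proof.
apply: le_trans (nrm_tri y _ _); apply: defect_le.
exact: (orth_proj_in norm_dot (cL k)).
Qed.

Lemma nrm_projs_le (l : seq 'I_K) x : nrm (Q x l) <= nrm x.
Proof.
elim: l x => //= k l ih x; apply: le_trans (ih _) _.
exact: (nrm_proj_le norm_dot (cL k)).
Qed.

Lemma projsB (l : seq 'I_K) x y : Q (x - y) l = Q x l - Q y l.
Proof.
by elim: l x y => //= k l ih x y; rewrite (orth_projB norm_dot (cL k)) ih.
Qed.

Lemma projs_nonexp (l : seq 'I_K) x y : nrm (Q x l - Q y l) <= nrm (x - y).
Proof. by rewrite -projsB nrm_projs_le. Qed.

Lemma projs_orth_cap (l : seq 'I_K) x : M x -> M (Q x l).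
Proof. by elim: l x => //= k l ih x Mx; apply/ih/proj_orth_cap. Qed.

Lemma projsD (l : seq 'I_K) x y : Q (x + y) l = Q x l + Q y l.
Proof.
by elim: l x y => //= k l ih x y; rewrite (orth_projD norm_dot (cL k)) ih.
Qed.

Lemma projs_sum (l : seq 'I_K) I (r : seq I) (p : pred I) (f : I -> H) :
  Q (\sum_(i <- r | p i) f i) l = \sum_(i <- r | p i) Q (f i) l.
Proof.
apply: (big_morph (Q^~ l) (projsD l)).
by elim: l => //= k l ih; rewrite (orth_proj0 norm_dot (cL k)).
Qed.

Lemma projsZ (l : seq 'I_K) a x : Q (a *: x) l = a *: Q x l.
Proof.
by elim: l x => //= k l ih x; rewrite (orth_projZ norm_dot (cL k)) ih.
Qed.

Lemma projs_cap (l : seq 'I_K) x : L x -> Q x l = x.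
Proof.
move=> Lx; elim: l => //= k l ih.
by rewrite (orth_proj_id norm_dot (cL k)) //; exact: Lx.
Qed.

(** By Pythagoras the total loss of squared norm is the sum of the squared lengths of the single
    moves, so each move has length at most e. When letter k is applied the path enters [Lk k], still
    within (size l) e of x. *)
Lemma projs_displacement (l : seq 'I_K) x (e : R) : 0 <= e ->
    nrm x ^+ 2 - nrm (Q x l) ^+ 2 <= e ^+ 2 ->
  nrm (x - Q x l) <= (size l)%:R * e /\
  forall k, k \in l -> defect k x <= (size l)%:R * e.
Proof.
move=> e0; elim: l x => [|k l ih] x /=.
  by move=> _; rewrite subrr nrm0 mul0r; split.
move=> h; have h1 := nrm_proj_sq norm_dot (cL k) x.
have h2 : nrm (Q (P (Lk k) x) l) ^+ 2 <= nrm (P (Lk k) x) ^+ 2.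
  by rewrite ler_pXn2r ?nnegrE ?nrm_ge0 ?nrm_projs_le.
have dk : defect k x <= e.
  by apply: nrm_le_sq => //; rewrite -/(proj_defect k x); move: h1 h; rewrite -/(proj_defect k x); lra.
have [|i1 i2] := ih (P (Lk k) x).
  by move: h1 h (sqr_ge0 (defect k x)); rewrite -/(proj_defect k x); lra.
have -> : (size l).+1%:R * e = e + (size l)%:R * e by rewrite -natr1 mulrDl mul1r addrC.
split.
  by apply: le_trans (nrm_tri (P (Lk k) x) _ _) _; rewrite lerD.
move=> j; rewrite inE => /orP[/eqP ->|jl].
  by rewrite (le_trans dk) // lerDl mulr_ge0.
by apply: le_trans (defect_tri j _ (P (Lk k) x)) _; rewrite lerD ?i2.
Qed.

(** Each defect of y is at most K times the square root of |y|^2 - |T y|^2, so regularity makes this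
    loss a fixed proportion of |y|^2. *)
Lemma regular_contraction : regular M ->
  exists2 q : R, 0 < q < 1 & forall n x, M x -> nrm (iter n T x) <= q ^+ n * nrm x.
Proof.
move=> [c c0 hc].
pose A : R := K%:R ^+ 4; pose C : R := c ^+ 2.
have A0 : 0 <= A by rewrite exprn_ge0.
have C0 : 0 < C by rewrite exprn_gt0.
(* With Y = |y|^2 and Z = |T y|^2, the inequalities C Y <= A (Y - Z) and Z <= Y give (A + C + 1) Z
   <= (A + 1) Y. The summand 1 keeps [q2] positive whatever A >= 0 is. *)
pose q2 := (A + 1) / (A + C + 1).
have D0 : 0 < A + C + 1 by rewrite ltr_wpDl // addr_ge0 // ltW.
have q20 : 0 < q2 by rewrite divr_gt0 // ltr_wpDl.
have q21 : q2 < 1 by rewrite ltr_pdivrMr // mul1r; lra.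
exists (Num.sqrt q2).
  by rewrite sqrtr_gt0 q20 -sqrtr1 ltr_sqrt.
move=> n x Mx.
have step y : M y -> nrm (T y) <= Num.sqrt q2 * nrm y.
  move=> My; have h : nrm (T y) <= nrm y by exact: nrm_projs_le.
  have e0 : 0 <= nrm y ^+ 2 - nrm (T y) ^+ 2.
    by rewrite subr_ge0 ler_pXn2r ?nnegrE ?nrm_ge0.
  have [|_ hd] := @projs_displacement (enum 'I_K) y (Num.sqrt (nrm y ^+ 2 - nrm (T y) ^+ 2)) (sqrtr_ge0 _).
    by rewrite sqr_sqrtr.
  have : c * nrm y <= K%:R * (K%:R * Num.sqrt (nrm y ^+ 2 - nrm (T y) ^+ 2)).
    apply: le_trans (hc y My) _.
    apply: (@le_trans _ _ (\sum_(k < K) (K%:R * Num.sqrt (nrm y ^+ 2 - nrm (T y) ^+ 2)))).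
      by apply: ler_sum => k _; move: (hd k); rewrite size_enum_ord mem_enum; apply.
    by rewrite sumr_const card_ord -[leLHS]mulr_natl.
  rewrite -(@ler_pXn2r _ 2) ?nnegrE ?mulr_ge0 ?sqrtr_ge0 ?nrm_ge0 ?(ltW c0) //.
  rewrite !exprMn sqr_sqrtr // mulrA -exprMn -expr2 -exprM -/A -/C => hh.
  apply: nrm_le_sq; first by rewrite mulr_ge0 ?sqrtr_ge0 ?nrm_ge0.
  rewrite exprMn sqr_sqrtr ?(ltW q20) // /q2 mulrAC ler_pdivlMr //.
  move: hh e0; set Y := nrm y ^+ 2; set Z := nrm (T y) ^+ 2 => hh e0.
  rewrite exprMn -/C -/Y in hh.
  have hC : C * Z <= C * Y by rewrite ler_wpM2l ?(ltW C0) // -subr_ge0.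
  lra.
elim: n => [|n ih]; first by rewrite expr0 mul1r.
have Mn : M (iter n T x).
  by elim: n {ih} => //= n ih; exact: projs_orth_cap.
rewrite iterS exprS; apply: le_trans (step _ Mn) _.
by rewrite -mulrA ler_wpM2l ?sqrtr_ge0.
Qed.

Lemma iter_T_orth n x : M x -> M (iter n T x).
Proof. by move=> Mx; elim: n => //= n ih; exact: projs_orth_cap. Qed.

Lemma iter_TB n x y : iter n T (x - y) = iter n T x - iter n T y.
Proof. by elim: n => //= n ->; exact: projsB. Qed.

Lemma iter_T_cap n x : L x -> iter n T x = x.
Proof. by move=> Lx; elim: n => //= n ->; exact: projs_cap. Qed.

Lemma iter_T_sub n z : iter n T z - P L z = iter n T (z - P L z).
Proof.
rewrite iter_TB (@iter_T_cap _ (P L z)) //.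
exact: (orth_proj_in norm_dot closed_subspace_cap).
Qed.

Lemma sub_proj_cap z : M (z - P L z).
Proof. by case: (orth_projP norm_dot closed_subspace_cap z). Qed.

Lemma perp_sumD x y : perp_sum x -> perp_sum y -> perp_sum (x + y).
Proof.
move=> [u hu ->] [v hv ->]; exists (fun k => u k + v k); last by rewrite big_split.
by move=> k; apply: (subspaceD (orthocomp_closed norm_dot _)).
Qed.

Lemma perp_sum_in k x : orthocomp (Lk k) x -> perp_sum x.
Proof.
move=> hx; exists (fun j => if j == k then x else 0).
  by move=> j; case: eqP => [->//|_] y _; rewrite dot0l.
by rewrite -big_mkcond big_pred1_eq.
Qed.

Lemma perp_sum0 : perp_sum 0.
Proof. by exists (fun=> 0); [move=> k y _; rewrite dot0l|rewrite big1]. Qed.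

Lemma perp_sum_projs (l : seq 'I_K) x : perp_sum (x - Q x l).
Proof.
elim: l x => [|k l ih] x /=; first by rewrite subrr; exact: perp_sum0.
rewrite -[x - _](subrKA (P (Lk k) x)); apply: perp_sumD => //.
by apply: (@perp_sum_in k); case: (orth_projP norm_dot (cL k) x).
Qed.

Lemma perp_sum_sub : perp_sum `<=` M.
Proof.
move=> _ [u hu ->] y Ly; rewrite dot_suml big1 // => k _.
by apply: hu; exact: Ly.
Qed.

(** The Neumann series y = sum_i T^i x converges for x in M and solves y - T y = x; a difference y -
    T y telescopes into moves orthogonal to the single [Lk k]. *)
Lemma regular_perp_sum : regular M -> perp_sum = M.
Proof.
move=> /regular_contraction [q /andP[q0 q1] hq].
apply/seteqP; split; first exact: perp_sum_sub.
move=> x Mx.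
pose u n := \sum_(i < n) iter i T x.
have uS n : u n.+1 = u n + iter n T x by rewrite /u big_ord_recr.
have Mu n : M (u n).
  by apply: subspace_sum => [|i _]; [exact: closed_subspace_M|exact: iter_T_orth].
have uT n : u n.+1 - T (u n) = x.
  elim: n => [|n ih].
    rewrite /u big_ord0 big_ord_recr big_ord0 /= add0r.
    by rewrite (_ : T 0 = 0) ?subr0 //; apply: projs_cap; exact: subspace0 closed_subspace_cap.
  rewrite uS (uS n) -[X in T (u n + X)]opprK; rewrite /proj_product projsB.
  rewrite -/(T (u n)) -/(T (- iter n T x)) -[- iter n T x]sub0r /proj_product projsB.
  rewrite (@projs_cap _ 0); last exact: subspace0 closed_subspace_cap.
  rewrite sub0r opprK -[RHS]ih uS [iter n.+1 T x]iterS -/(T _).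
  by rewrite opprD addrACA subrr addr0.
have qq : 0 < q < 1 by rewrite q0.
have [n|y hy0] := @geometric_limit _ _ _ u (nrm x) q qq.
  by rewrite uS addrC addKr mulrC; exact: hq.
have hy := geometric_limitP qq hy0.
suff -> : x = y - T y by exact: perp_sum_projs.
apply/eqP; rewrite eq_sym -subr_eq0; apply/eqP/nrm_eq0/eqP.
rewrite eq_le nrm_ge0 andbT; apply/ler_addgt0Pr => e e0; rewrite add0r.
have [N hN] := hy (e / 2) (divr_gt0 e0 (ltr0n _ 2)).
have -> : y - T y - x = (y - u N.+1) - (T y - T (u N)).
  by rewrite -{1}(uT N) !opprB [T (u N) - u N.+1]addrC addrACA [- T y + _]addrC.
apply: le_trans (nrmD _ _) _; rewrite nrmN -projsB.
have := nrm_projs_le (enum 'I_K) (y - u N).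
rewrite (nrmB y (u N.+1)) [nrm (y - u N)]nrmB.
have := hN N (leqnn _); have := hN N.+1 (leqnSn _); lra.
Qed.
End Family.

(** * Arbitrarily slow convergence and the failure of regularity *)

Section Slow.
Context (R : realType) (s : scalar_kind).
Context (H : completeNormedModType (scalars R s)).
Context (dot : {dot H for @scalar_conj R s}).
Hypothesis norm_dot : forall x : H, `|x| ^+ 2 = dot x x.
Local Notation F := (scalars R s).
Local Notation ofr := (@of_real R s).
Local Notation orthocomp := (orthocomp dot).
Local Notation P := (orth_proj dot).
Implicit Types (x y z : H) (a b : F) (r t : R).

Context (K : nat) (Lk : 'I_K -> set H).
Hypothesis cL : forall k, closed_subspace (Lk k).
Local Notation L := (\bigcap_k Lk k).
Local Notation M := (orthocomp L).
Local Notation T := (proj_product dot Lk).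
Local Notation Q := (foldl (fun y k => P (Lk k) y)).
Local Notation defect := (proj_defect dot Lk).
Local Notation regular := (regular dot Lk).

Definition slow := forall a : nat -> R, a @ \oo --> (0 : R) ->
  exists z, forall n, `|iter n T z - P L z| >= ofr (a n).

(** Regularity gives a rate q^n, which no starting point can keep above p^n for q < p < 1. *)
Lemma slow_not_regular : slow -> ~ regular M.
Proof.
move=> hs /(regular_contraction norm_dot cL) [q /andP[q0 q1] hq].
pose p := (1 + q) / 2.
have p0 : 0 < p by rewrite /p; lra.
have p1 : p < 1 by rewrite /p; lra.
have qp : q < p by rewrite /p; lra.
have [|z hz] := hs (fun n => p ^+ n).
  by apply: cvg_expr; rewrite ger0_norm // ltW.
have r01 : 0 <= q / p < 1 by rewrite divr_ge0 ?ltW //= ltr_pdivrMr // mul1r.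
have [N /(_ N (leqnn _)) hN] := geometric_small (nrm (z - P L z)) r01 ltr01.
have := hz N; rewrite (iter_T_sub norm_dot cL) normE_nrm ler_of_real.
rewrite leNgt => /negP; apply; apply: le_lt_trans (hq _ _ (sub_proj_cap norm_dot cL z)) _.
by move: hN; rewrite expr_div_n mulrAC ltr_pdivrMr ?exprn_gt0 // mul1r.
Qed.

(** If every unit vector of X had some defect above e, then by homogeneity e would be a constant of
    regularity. *)
Lemma not_regular_almost_fixed (X : set H) : closed_subspace X -> ~ regular X ->
  forall e : R, 0 < e -> exists x, [/\ X x, nrm x = 1 & forall k, defect k x <= e].
Proof.
move=> cX nX e e0; apply: contrapT => h; apply: nX; exists e => // x Xx.
have [->|x0] := eqVneq x 0.
  by rewrite nrm0 mulr0 sumr_ge0 // => k _; exact: nrm_ge0.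
have np : 0 < nrm x.
  by rewrite lt_def nrm_ge0 andbT; apply: contra x0 => /eqP/nrm_eq0 ->.
pose y := ofr (nrm x)^-1 *: x.
have [k hk] : exists k, e < defect k y.
  apply: contrapT => hk; apply: h; exists y; split; first exact: subspaceZ.
    by rewrite nrmZr ger0_norm ?invr_ge0 ?ltW // mulVf // gt_eqF.
  by move=> k; rewrite leNgt; apply/negP => hh; apply: hk; exists k.
rewrite (bigD1 k) //= -[leLHS]addr0 lerD ?sumr_ge0 //; last by move=> j _; exact: nrm_ge0.
move: hk; rewrite /proj_defect (orth_projZ norm_dot (cL k)) -scalerBr nrmZr.
by rewrite gtr0_norm ?invr_gt0 // ltr_pdivlMl // mulrC => /ltW.
Qed.

Lemma almost_fixed_projs (l : seq 'I_K) x (e : R) :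
  (forall k, k \in l -> defect k x <= e) -> nrm (x - Q x l) <= (size l)%:R * e.
Proof.
elim: l => [|k l ih] he /=; first by rewrite subrr nrm0 mul0r.
apply: le_trans (nrm_tri (Q x l) _ _) _; rewrite -natr1 mulrDl mul1r lerD //.
  by apply: ih => j jl; apply: he; rewrite inE jl orbT.
rewrite -(projsB norm_dot cL); apply: le_trans (nrm_projs_le norm_dot cL _ _) _.
by apply: he; rewrite inE eqxx.
Qed.

Lemma almost_fixed_iter n x (e : R) :
  (forall k, defect k x <= e) -> nrm (x - iter n T x) <= n%:R * (K%:R * e).
Proof.
move=> he; elim: n => [|n ih] /=; first by rewrite subrr nrm0 mul0r.
apply: le_trans (nrm_tri (T x) _ _) _; rewrite -natr1 mulrDl mul1r addrC lerD //.
  rewrite -(projsB norm_dot cL); apply: le_trans (nrm_projs_le norm_dot cL _ _) ih.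
by rewrite -[K in K%:R]size_enum_ord; apply: almost_fixed_projs.
Qed.

Lemma nrm_iter_T_le n m x : (n <= m)%N -> nrm (iter m T x) <= nrm (iter n T x).
Proof.
elim: m => [|m ih]; first by rewrite leqn0 => /eqP ->.
rewrite leq_eqVlt => /orP[/eqP -> //|/ih h].
exact: le_trans (nrm_projs_le norm_dot cL _ _) h.
Qed.

Lemma iter_TD n x y : iter n T (x + y) = iter n T x + iter n T y.
Proof.
rewrite -[y in LHS]opprK (iter_TB norm_dot cL) -[- y]sub0r (iter_TB norm_dot cL).
by rewrite (iter_T_cap norm_dot cL n (subspace0 (closed_subspace_cap cL))) sub0r opprK.
Qed.

Lemma iter_T_contract n x : nrm (iter n T x) <= nrm x.
Proof. exact: (@nrm_iter_T_le 0). Qed.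

(* A gliding hump: at step j a multiple 3^-j of an almost fixed vector is added with
   the sign which keeps T^(N j) z large; the later steps cannot spoil this. *)
Lemma not_regular_slow : ~ regular M -> slow.
Proof.
move=> nM a a0.
pose h : R := 3^-1.
have [A A0 hA] : exists2 A : R, 0 < A & forall n, a n <= A.
  have /cvgrPdist_lt/(_ _ ltr01) [N _ hN] := a0.
  exists (1 + \sum_(i < N) `|a i|).
    by rewrite ltr_wpDr // sumr_ge0.
  move=> n; have [Nn|nN] := leqP N n.
    have := hN n Nn; rewrite /= sub0r normrN => /ltW h1.
    by apply: le_trans (ler_norm _) (le_trans h1 _); rewrite lerDl sumr_ge0.
  rewrite (bigD1 (Ordinal nN)) //= addrCA; apply: le_trans (ler_norm _) _.
  by rewrite lerDl addr_ge0 ?sumr_ge0.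
(* With ratio 1/3 the terms after step j add up to c_j / 2, which leaves c_j / 4 of the 3 c_j / 4
   secured at step j. The factor 4 A makes c_0 / 4 a bound of the whole sequence. *)
pose c j := 4 * A * h ^+ j.
have c0 j : 0 < c j by rewrite !mulr_gt0 ?exprn_gt0 ?invr_gt0.
have cS j : c j.+1 = c j / 3 by rewrite /c exprSr mulrA.
have /choice [N hN] : forall j, exists Nj, forall n, (Nj <= n)%N -> a n <= c j.+1 / 4.
  move=> j; have e0 : 0 < c j.+1 / 4 by rewrite divr_gt0.
  have /cvgrPdist_lt/(_ _ e0) [Nj _ hNj] := a0.
  exists Nj => n Nn; have := hNj n Nn; rewrite /= sub0r normrN => /ltW.
  exact/le_trans/ler_norm.
(* The maximum with j makes these indices unbounded, so that every n lies below one of them. *)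
pose N' j := maxn (N j) j.
have /choice [x hx] : forall j, exists x, [/\ M x, nrm x = 1 & 3 / 4 <= nrm (iter (N' j) T x)].
  move=> j; pose e : R := (4 * ((N' j)%:R * K%:R + 1))^-1.
  have d0 : 0 < (N' j)%:R * K%:R + 1 :> R by rewrite ltr_wpDl // mulr_ge0.
  have e0 : 0 < e by rewrite invr_gt0 mulr_gt0.
  have [x [Mx x1 dx]] := not_regular_almost_fixed (closed_subspace_M norm_dot Lk) nM e0.
  exists x; split => //.
  have h1 := almost_fixed_iter (N' j) dx.
  have h2 : (N' j)%:R * (K%:R * e) <= 1 / 4.
    rewrite mulrA /e invfM mulrCA mul1r -[leRHS]mulr1 ler_wpM2l ?invr_ge0 //.
    by rewrite ler_pdivrMr // mul1r lerDl.
  have := nrm_sub_le x (iter (N' j) T x); rewrite x1.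
  lra.
pose v j := ofr (c j) *: x j.
pose step z j := if nrm (iter (N' j) T (v j)) <= nrm (iter (N' j) T (z + v j))
                 then z + v j else z - v j.
pose u := fix u j := if j is j'.+1 then step (u j') j' else 0.
have vn j : nrm (v j) = c j.
  by rewrite nrmZr gtr0_norm //; case: (hx j) => _ -> _; rewrite mulr1.
have Mv j : M (v j).
  by apply: (subspaceZ (closed_subspace_M norm_dot Lk)); case: (hx j).
have uS j : nrm (u j.+1 - u j) = c j.
  rewrite /= /step; case: ifP => _; first by rewrite addrC addKr.
  by rewrite addrAC subrr sub0r nrmN.
have Mu j : M (u j).
  elim: j => [|j ih]; first exact: subspace0 (closed_subspace_M norm_dot Lk).
  rewrite /= /step; case: ifP => _.
    exact: (subspaceD (closed_subspace_M norm_dot Lk)).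
  exact: (subspaceB (closed_subspace_M norm_dot Lk)).
have big j : nrm (iter (N' j) T (v j)) <= nrm (iter (N' j) T (u j.+1)).
  rewrite /= /step; case: ifP => // /negbT; rewrite -ltNge.
  (* Since 2 v is the difference of u + v and u - v, one of the two signs keeps the image at least
     as large as that of v. *)
  move=> lt1; have E : v j + v j = (u j + v j) - (u j - v j).
    by rewrite opprB [RHS]addrC subrKA.
  have := nrmD (iter (N' j) T (u j + v j)) (- iter (N' j) T (u j - v j)).
  rewrite -(iter_TB norm_dot cL (N' j) (u j + v j)) -E (iter_TD (N' j) (v j)) nrmN.
  have -> : iter (N' j) T (v j) + iter (N' j) T (v j) = ofr 2 *: iter (N' j) T (v j).
    by rewrite -[X in X + X]scale1r -scalerDl -(of_real1 R s) -of_realD.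
  by rewrite nrmZr ger0_norm //; lra.
have h01 : 0 < h < 1 by apply/andP; split; rewrite /h; lra.
have [j|z hz] := @geometric_limit _ _ _ u (4 * A) h h01; first by rewrite uS.
have Mz : M z := subspace_lim (closed_subspace_M norm_dot Lk) Mu (geometric_limitP h01 hz).
have zj j : c j / 4 <= nrm (iter (N' j) T z).
  have h1 : nrm (u j.+1 - z) <= c j / 2.
    by have := hz j.+1; rewrite -/(c j.+1) cS /h; lra.
  have h2 : c j * (3 / 4) <= nrm (iter (N' j) T (v j)).
    have [_ _ hj] := hx j.
    have -> : iter (N' j) T (v j) = ofr (c j) *: iter (N' j) T (x j).
      by rewrite /v; elim: (N' j) => //= n ->; rewrite /proj_product (projsZ norm_dot cL).
    by rewrite nrmZr gtr0_norm // ler_pM2l.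
  have h3 := big j.
  have h4 := iter_T_contract (N' j) (u j.+1 - z).
  rewrite (iter_TB norm_dot cL) in h4.
  have := nrm_sub_le (iter (N' j) T (u j.+1)) (iter (N' j) T z).
  by have := c0 j; lra.
exists z => n; rewrite normE_nrm ler_of_real.
rewrite (orth_proj_eq0 norm_dot (closed_subspace_cap cL)) // subr0.
have [nN|Nn] := ltnP n (N' 0%N).
  apply: le_trans (nrm_iter_T_le z (ltnW nN)); apply: le_trans (zj 0%N).
  by rewrite /c expr0 mulr1 mulrC mulKf //; exact: hA.
(* For the least such index j + 1, n >= [N' j] bounds a_n by c_(j+1) / 4, while n < [N' j.+1] keeps
   the n-th iterate of z above it. *)
have ex : exists j, (n < N' j)%N by exists n.+1; rewrite leq_max ltnSn orbT.
case: (ex_minnP ex) => -[|j] hj hmin; first by rewrite ltnNge Nn in hj.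
have jn : (N' j <= n)%N by rewrite leqNgt; apply/negP => /hmin; rewrite ltnn.
apply: le_trans (nrm_iter_T_le z (ltnW hj)); apply: le_trans (zj j.+1).
by apply: hN; rewrite (leq_trans _ jn) // leq_maxl.
Qed.
End Slow.

(** * Almost common vectors *)

Section AlmostFixed.
Context (R : realType) (s : scalar_kind).
Context (H : completeNormedModType (scalars R s)).
Context (dot : {dot H for @scalar_conj R s}).
Hypothesis norm_dot : forall x : H, `|x| ^+ 2 = dot x x.
Local Notation F := (scalars R s).
Local Notation ofr := (@of_real R s).
Local Notation orthocomp := (orthocomp dot).
Local Notation P := (orth_proj dot).
Local Notation ip := (re_dot dot).
Implicit Types (x y z : H) (a b : F) (r t : R).

Context (K : nat) (Lk : 'I_K -> set H).
Hypothesis cL : forall k, closed_subspace (Lk k).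
Local Notation L := (\bigcap_k Lk k).
Local Notation M := (orthocomp L).
Local Notation perp_sum := (sum_sets (fun k => orthocomp (Lk k))).
Local Notation defect := (proj_defect dot Lk).
Local Notation regular := (regular dot Lk).

Lemma defectD k x y : defect k (x + y) <= defect k x + defect k y.
Proof. by rewrite /proj_defect (orth_projD norm_dot (cL k)) opprD addrACA nrmD. Qed.

Lemma defectZ k a x : defect k (a *: x) = modulus a * defect k x.
Proof. by rewrite /proj_defect (orth_projZ norm_dot (cL k)) -scalerBr nrmZ. Qed.

Lemma defect_le_nrm k x : defect k x <= nrm x.
Proof.
by rewrite -[x in leRHS]subr0; apply: (defect_le norm_dot cL); exact: subspace0 (cL k).
Qed.

Local Notation D x := (\sum_k defect k x).

Lemma sum_defectD x y : D (x + y) <= D x + D y.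
Proof. by rewrite -big_split ler_sum // => k _; exact: defectD. Qed.

Lemma sum_defectZ a x : D (a *: x) = modulus a * D x.
Proof. by rewrite mulr_sumr; apply: eq_bigr => k _; rewrite defectZ. Qed.

Lemma sum_defectN x : D (- x) = D x.
Proof. by apply: eq_bigr => k _; rewrite /proj_defect (orth_projN norm_dot (cL k)) -opprD nrmN. Qed.

Lemma sum_defect_le x : D x <= K%:R * nrm x.
Proof.
apply: (@le_trans _ _ (\sum_(k < K) nrm x)).
  by apply: ler_sum => k _; exact: defect_le_nrm.
by rewrite sumr_const card_ord mulr_natl.
Qed.

Lemma sum_defect_ge0 x : 0 <= D x.
Proof. by rewrite sumr_ge0 // => k _; exact: nrm_ge0. Qed.

Lemma sum_defect_eq0 x : M x -> D x = 0 -> x = 0.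
Proof.
move=> Mx Dx; suff Lx : L x.
  by apply/nrm_eq0/eqP; rewrite -[_ == _](@expf_eq0 _ _ 2) -(ipxx norm_dot) dot_ip0 ?Mx.
move=> k _; have : defect k x == 0.
  move/eqP: Dx; rewrite psumr_eq0 => [/allP/(_ k (mem_index_enum _))//|j _].
  exact: nrm_ge0.
move=> /eqP/nrm_eq0/eqP; rewrite subr_eq0 => /eqP ->.
exact: (orth_proj_in norm_dot (cL k)).
Qed.

(* Adding one dimension cannot destroy regularity: if it did, the restriction of the
   defects to the hyperplane would be bounded below and yet approach their value at x0,
   whence a nonzero vector of M without defect. *)
Lemma regular_hyperplane (X : set H) f : closed_subspace X -> X `<=` M ->
  regular (X `&` orthocomp [set f]) -> regular X.
Proof.
move=> cX XM [c c0 hc].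
have [[x1 Xx1 x1f]|nf] := pselect (exists2 x, X x & dot x f != 0); last first.
  exists c => // x Xx; apply: hc; split => // _ ->; apply/eqP/negPn/negP => xf.
  by apply: nf; exists x.
pose x0 := (dot x1 f)^-1 *: x1.
have Xx0 : X x0 by exact: subspaceZ.
have x0f : dot x0 f = 1 by rewrite dotZl mulVf.
have cG := closed_subspaceI cX (orthocomp_closed norm_dot [set f]).
set G := X `&` _ in cG hc.
(* Otherwise some g_n in G have D (x0 - g_n) tending to 0. They are Cauchy by regularity on G, and
   their limit is x0 by [sum_defect_eq0]; but x0 is not orthogonal to f. *)
have [del del0 hdel] : exists2 del : R, 0 < del & forall g, G g -> del <= D (x0 - g).
  apply: contrapT => h.
  have /choice [g hg] : forall n : nat, exists g, G g /\ D (x0 - g) < n.+1%:R^-1.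
    move=> n; apply: contrapT => hn; apply: h; exists n.+1%:R^-1; first by rewrite invr_gt0.
    by move=> g Gg; rewrite leNgt; apply/negP => hh; apply: hn; exists g.
  have inv_small (e : R) : 0 < e -> exists N, forall n, (N <= n)%N -> n.+1%:R^-1 < e.
    move=> e0; exists (Num.truncn e^-1) => n Nn.
    rewrite invf_plt ?posrE //; apply: lt_le_trans (truncnS_gt _) _.
    by rewrite ler_nat ltnS.
  have cg e : 0 < e -> exists N, forall m n, (N <= m)%N -> (N <= n)%N -> nrm (g m - g n) < e.
    move=> e0; have e1 : 0 < c * e / 2 by rewrite divr_gt0 // mulr_gt0.
    have [N hN] := inv_small _ e1; exists N => m n Nm Nn.
    have [Gm dm] := hg m; have [Gn dn] := hg n.
    rewrite -(ltr_pM2l c0); apply: le_lt_trans (hc _ (subspaceB cG Gm Gn)) _.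
    have -> : g m - g n = (x0 - g n) - (x0 - g m) by rewrite opprB [RHS]addrC subrKA.
    apply: le_lt_trans (sum_defectD _ _) _; rewrite sum_defectN.
    have := lt_trans dm (hN m Nm); have := lt_trans dn (hN n Nn).
    by clear dm dn; lra.
  have [l hl] := complete_nrm cg.
  have Gl : G l by apply: (subspace_lim cG _ hl) => n; case: (hg n).
  have : x0 - l = 0.
    apply: sum_defect_eq0; first by apply: XM; apply: subspaceB => //; case: Gl.
    apply/eqP; rewrite eq_le sum_defect_ge0 andbT; apply/ler_addgt0Pr => e e0.
    rewrite add0r; have Kp : 0 < K%:R + 1 :> R by rewrite ltr_wpDl.
    have [N1 h1] := inv_small _ (divr_gt0 e0 (ltr0n _ 2)).
    have [N2 h2] := hl _ (divr_gt0 (divr_gt0 e0 (ltr0n _ 2)) Kp).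
    have {}h1 := h1 (maxn N1 N2) (leq_maxl _ _).
    have {}h2 := h2 (maxn N1 N2) (leq_maxr _ _).
    have [_ h3] := hg (maxn N1 N2).
    rewrite -(subrKA (g (maxn N1 N2))).
    apply: le_trans (sum_defectD _ _) _.
    have h4 := sum_defect_le (g (maxn N1 N2) - l).
    have h5 : K%:R * nrm (g (maxn N1 N2) - l) <= e / 2.
      rewrite ltr_pdivlMr // in h2; apply: le_trans (ltW h2).
      by rewrite mulrC ler_wpM2l ?nrm_ge0 // lerDl.
    by rewrite [e in leRHS]splitr lerD // ?(le_trans h4) // ltW // (lt_trans h3).
  move=> /eqP; rewrite subr_eq0 => /eqP x0l.
  have : dot x0 f = 0 by rewrite x0l; case: Gl => _; apply.
  by rewrite x0f => /eqP; rewrite oner_eq0.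
(* Write x = t x0 + g with g in G. Then |t| <= D x / del and c |g| <= D x + |t| D x0; A collects the
   constants of |x| <= A D x. *)
pose A := (nrm x0 + D x0 / c) / del + c^-1.
have A0 : 0 < A.
  rewrite ltr_wpDl ?invr_gt0 // divr_ge0 ?(ltW del0) // addr_ge0 ?nrm_ge0 //.
  by rewrite divr_ge0 ?sum_defect_ge0 ?ltW.
exists A^-1; first by rewrite invr_gt0.
move=> x Xx; rewrite ler_pdivrMl //.
set t := dot x f; set g := x - t *: x0.
have Gg : G g.
  split; first by apply: subspaceB => //; exact: subspaceZ.
  by move=> _ ->; rewrite dotBl dotZl x0f mulr1 subrr.
have h1 : modulus t * del <= D x.
  have [t0|t0] := eqVneq t 0.
    by rewrite t0 -(of_real0 R s) modulus_real normr0 mul0r sum_defect_ge0.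
  have -> : x = t *: (x0 - (- t^-1 *: g)).
    by rewrite scaleNr opprK scalerDr [t *: (_ *: g)]scalerA divff // scale1r addrC subrK.
  rewrite sum_defectZ ler_wpM2l ?modulus_ge0 // hdel //; exact: subspaceZ.
have h2 : c * nrm g <= D x + modulus t * D x0.
  apply: le_trans (hc _ Gg) _; apply: le_trans (sum_defectD _ _) _.
  by rewrite sum_defectN sum_defectZ.
have h3 : nrm x <= modulus t * nrm x0 + nrm g.
  rewrite -[x in leLHS](subrK (t *: x0)) addrC -/g; apply: le_trans (nrmD _ _) _.
  by rewrite nrmZ.
rewrite -ler_pdivlMl // in h2; rewrite -ler_pdivlMr // in h1.
have := sum_defect_ge0 x0; have := nrm_ge0 x0.
move: h1 h2 h3; rewrite /A mulrDl; set Dx := D x; set D0 := D x0; set n0 := nrm x0.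
move=> h1 h2 h3 n0p D0p.
apply: le_trans h3 _; apply: le_trans (lerD (lexx _) h2) _.
have -> : modulus t * n0 + c^-1 * (Dx + modulus t * D0) =
   (n0 + D0 / c) * modulus t + c^-1 * Dx by ring.
rewrite lerD2r [leRHS]mulrAC -mulrA ler_wpM2l //.
  by rewrite addr_ge0 // divr_ge0 // ltW.
Qed.

(** One application of [regular_hyperplane] per vector of [fs]: regularity depends only on M up to
    finite codimension. *)
Lemma not_regular_orth (fs : seq H) : ~ regular M -> ~ regular (M `&` orthocomp [set` fs]).
Proof.
move=> nM; elim: fs => [|f fs ih].
  suff -> : orthocomp [set` [::]] = setT by rewrite setIT.
  by apply/seteqP; split => // x _ y.
apply: contra_not ih => hr.
apply: (@regular_hyperplane _ f).
- exact: (closed_subspaceI (closed_subspace_M norm_dot Lk) (orthocomp_closed norm_dot _)).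
- by move=> x [].
rewrite -setIA; suff -> : orthocomp [set` fs] `&` orthocomp [set f] = orthocomp [set` f :: fs].
  by [].
apply/seteqP; split => [x [h1 h2] y /=|x h].
  by rewrite inE => /orP[/eqP ->|yfs]; [exact: h2|exact: h1].
split => [y /= yfs|_ ->]; apply: h => /=; rewrite inE ?eqxx // [y \in fs]yfs orbT //.
Qed.

(** The normalised projections of one almost fixed unit vector x onto the K spaces are all close to
    x, hence to one another. *)
Lemma almost_common_step : ~ regular M -> forall (fs : seq H) (e : R), 0 < e ->
  exists t : 'I_K -> H,
    [/\ forall k, Lk k (t k) /\ M (t k), forall k, nrm (t k) = 1,
        forall k f, f \in fs -> dot (t k) f = 0 &
        forall k l, nrm (t k - t l) <= e].
Proof.
move=> nM fs e e0.
(* P(L_k) x is orthogonal to f exactly when x is orthogonal to P(L_k) f. *)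
pose fs' := [seq P (Lk k) f | f <- fs, k <- enum 'I_K].
(* The bound 1/2 keeps the projections away from 0; projecting and normalising then move x by at
   most e / 4 each. *)
pose e' := Num.min (e / 4) (1 / 2).
have e'0 : 0 < e' by rewrite lt_min !divr_gt0.
have e'1 : e' <= 1 / 2 by rewrite ge_min lexx orbT.
have e'e : e' <= e / 4 by rewrite ge_min lexx.
have cX := closed_subspaceI (closed_subspace_M norm_dot Lk) (orthocomp_closed norm_dot [set` fs']).
have [x [[Mx xfs] x1 dx]] :=
  not_regular_almost_fixed norm_dot cL cX (@not_regular_orth fs' nM) e'0.
pose n k := nrm (P (Lk k) x).
have n1 k : n k <= 1 by rewrite -x1 (nrm_proj_le norm_dot (cL k)).
have n2 k : 1 - e' <= n k.
  by have := nrm_sub_le x (P (Lk k) x); have := dx k; rewrite /proj_defect x1 -/(n k); lra.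
have n0 k : 0 < n k by apply: lt_le_trans (n2 k); lra.
pose t k := ofr (n k)^-1 *: P (Lk k) x.
have tx k : nrm (t k - x) <= e / 2.
  apply: le_trans (nrm_tri (P (Lk k) x) _ _) _.
  have h1 : nrm (t k - P (Lk k) x) <= e / 4.
    rewrite -[X in _ - X]scale1r -(of_real1 R s) -scalerBl -of_realB nrmZr -/(n k).
    rewrite ger0_norm; last by rewrite subr_ge0 invf_ge1.
    by rewrite mulrBl mulVf ?gt_eqF // mul1r; have := n2 k; lra.
  by have := dx k; rewrite /proj_defect nrmB; lra.
exists t; split=> [k|k|k f ffs|k l].
- split.
    by apply: (subspaceZ (cL k)); exact: (orth_proj_in norm_dot (cL k)).
  by apply: (subspaceZ (closed_subspace_M norm_dot Lk)); exact: (proj_orth_cap norm_dot cL).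
- by rewrite nrmZr gtr0_norm ?invr_gt0 // mulVf // gt_eqF.
- rewrite dotZl (dot_proj norm_dot (cL k)) xfs ?mulr0 //=.
  by apply/allpairsP; exists (f, k); rewrite mem_enum.
- apply: le_trans (nrm_tri x _ _) _; rewrite (nrmB x).
  by have := tx k; have := tx l; lra.
Qed.

Lemma almost_common_sequence (eps : nat -> R) : ~ regular M -> (forall n, 0 < eps n) ->
  exists b : 'I_K -> nat -> H,
    [/\ forall k n, Lk k (b k n) /\ M (b k n), forall k n, nrm (b k n) = 1,
        forall k l n m, n != m -> dot (b k n) (b l m) = 0 &
        forall k l n, nrm (b k n - b l n) <= eps n].
Proof.
move=> nM eps0.
have /choice [st hst] : forall p : seq H * nat, exists t : 'I_K -> H,
    [/\ forall k, Lk k (t k) /\ M (t k), forall k, nrm (t k) = 1,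
        forall k f, f \in p.1 -> dot (t k) f = 0 &
        forall k l, nrm (t k - t l) <= eps p.2].
  by move=> [fs n] /=; exact: almost_common_step.
(* The list of all vectors chosen before stage n, for all k; the new ones are orthogonal to each of
   them. *)
pose hist := fix hist n := if n is m.+1 then
   hist m ++ [seq st (hist m, m) k | k <- enum 'I_K] else [::].
pose b k n := st (hist n, n) k.
have hb m l n : (m < n)%N -> b l m \in hist n.
  elim: n => // n ih; rewrite ltnS leq_eqVlt => /orP[/eqP ->|/ih h] /=.
    by rewrite mem_cat (map_f (st (hist n, n))) ?orbT ?mem_enum.
  by rewrite mem_cat h.
exists b; split=> [k n|k n|k l n m|k l n].
- by have [h _ _ _] := hst (hist n, n); exact: h.
- by have [_ h _ _] := hst (hist n, n); exact: h.
- rewrite neq_ltn => /orP[nm|mn].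
    by apply: dot_eq0C; have [_ _ h _] := hst (hist m, m); apply: h; exact: hb.
  by have [_ _ h _] := hst (hist n, n); apply: h; exact: hb.
- by have [_ _ _ h] := hst (hist n, n); exact: h.
Qed.

(** A closed sum equals M. Without regularity, l = sum_n 2^-n b_n lies in M, for b_n almost common
    up to 4^-n. If l = sum_k v_k with v_k orthogonal to L_k, then 2^-n = <b_n, l> is at most 4^-n
    sum_k |v_k|, which fails for large n. *)
Lemma closed_perp_sum_regular : (0 < K)%N -> closed perp_sum -> regular M.
Proof.
move=> K0 cS; apply: contrapT => nM.
have cSs : closed_subspace perp_sum.
  split=> //; first exact: perp_sum0.
  move=> a x y hx hy; apply: (perp_sumD norm_dot) => //.
  case: hx => [u hu ->]; exists (fun k => a *: u k); last by rewrite scaler_sumr.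
  by move=> k; apply: (subspaceZ (orthocomp_closed norm_dot _)).
have SM : M `<=` perp_sum.
  move=> x Mx; have [Sp hp] := orth_projP norm_dot cSs x.
  (* The remainder is orthogonal to every L_k^perp, hence lies in every L_k; as it also lies in M,
     it vanishes. *)
  have Lxp : L (x - P perp_sum x).
    move=> k _; apply: (orthocomp2 norm_dot (cL k)) => y hy; apply: hp.
    exact: perp_sum_in hy.
  suff -> : x = P perp_sum x by [].
  apply/eqP; rewrite -subr_eq0; apply/eqP/nrm_eq0/eqP.
  rewrite -[_ == _](@expf_eq0 _ _ 2) -(ipxx norm_dot); apply/eqP/dot_ip0.
  by rewrite {1}dotBl Mx // (dot_eq0C (hp _ Sp)) subr0.
pose k0 := Ordinal K0.
have q0 n : 0 < 4^-1 ^+ n :> R by rewrite exprn_gt0 // invr_gt0.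
have [b [bL b1 borth bclose]] := almost_common_sequence nM q0.
pose h : R := 2^-1.
have h01 : 0 < h < 1 by apply/andP; split; rewrite /h; lra.
have h0 : 0 < h by case/andP: h01.
pose u n := \sum_(i < n) ofr (h ^+ i) *: b k0 i.
have [n|l hl] := @geometric_limit _ _ _ u 1 h h01.
  rewrite /u big_ord_recr /= addrAC subrr add0r nrmZr b1 mulr1 mul1r ger0_norm //.
  by rewrite exprn_ge0 // ltW.
have Ml : M l.
  apply: (subspace_lim (closed_subspace_M norm_dot Lk) _ (geometric_limitP h01 hl)) => n.
  apply: (subspace_sum (closed_subspace_M norm_dot Lk)) => i _.
  by apply: (subspaceZ (closed_subspace_M norm_dot Lk)); case: (bL k0 i).
have [v hv lv] := SM l Ml.
pose C := \sum_k nrm (v k).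
have up n : ip (b k0 n) l <= 4^-1 ^+ n * C.
  have -> : ip (b k0 n) l = \sum_k ip (b k0 n - b k n) (v k).
    rewrite lv ip_sumr; apply: eq_bigr => k _; have bk : Lk k (b k n) by case: (bL k n).
    by rewrite /re_dot dotBl (dot_eq0C (hv k _ bk)) subr0.
  rewrite /C mulr_sumr; apply: ler_sum => k _.
  apply: le_trans (ler_norm _) (le_trans (ip_le norm_dot _ _) _).
  by rewrite ler_wpM2r ?nrm_ge0.
have lo n : h ^+ n = ip (b k0 n) l.
  have un m : (n < m)%N -> ip (b k0 n) (u m) = h ^+ n.
    move=> nm; rewrite /u ip_sumr.
    rewrite (bigD1 (Ordinal nm)) //= big1 ?addr0 => [|i inm].
      by rewrite ipZr (ipxx norm_dot) b1 expr1n mulr1.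
    rewrite ipZr dot_ip0 ?mulr0 // borth // eq_sym.
    by apply: contra inm => /eqP e; apply/eqP/val_inj.
  apply/eqP; rewrite -subr_eq0 -normr_le0; apply/ler_addgt0Pr => e e0; rewrite add0r.
  have [N hN] := geometric_limitP h01 hl e0.
  rewrite -(un (maxn N n.+1)) ?leq_maxr // -(ipNr dot) -ipDr.
  apply: le_trans (ip_le norm_dot _ _) _; rewrite b1 mul1r ltW //.
  by apply: hN; rewrite leq_maxl.
have hh : 0 <= h < 1 by rewrite (ltW h0); case/andP: h01.
have [N /(_ N (leqnn _)) hN] := geometric_small C hh ltr01.
have := up N; rewrite -lo leNgt => /negP; apply.
have -> : 4^-1 = h * h :> R by rewrite /h; lra.
rewrite exprMn -mulrA -[ltRHS]mulr1 ltr_pM2l // exprn_gt0 //.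
Qed.
End AlmostFixed.

(** * Random products of a regular family *)

Section RandomProducts.
Context (R : realType) (s : scalar_kind).
Context (H : completeNormedModType (scalars R s)).
Context (dot : {dot H for @scalar_conj R s}).
Hypothesis norm_dot : forall x : H, `|x| ^+ 2 = dot x x.
Local Notation F := (scalars R s).
Local Notation orthocomp := (orthocomp dot).
Local Notation P := (orth_proj dot).
Local Notation ip := (re_dot dot).
Implicit Types (x y z : H) (a b : F) (r t : R).

Context (K : nat) (Lk : 'I_K -> set H).
Hypothesis cL : forall k, closed_subspace (Lk k).
Local Notation L := (\bigcap_k Lk k).
Local Notation M := (orthocomp L).
Local Notation defect := (proj_defect dot Lk).
Local Notation regular := (regular dot Lk).

Section Words.
Variable (A : 'I_K -> set H).
Hypothesis cA : forall k, closed_subspace (A k).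
Local Notation W := (foldl (fun y k => P (A k) y)).

(* Words in two letters are, up to their first or last letter, palindromes, which makes
   their diagonal coefficients squares of norms. *)
Lemma two_letter_word (c d : 'I_K) (l : seq 'I_K) f x :
  {subset l <= [:: c; d]} -> f \in [:: c; d] -> A f x ->
  nrm (W x l) ^+ 2 <= ip x (W x l).
Proof.
move: {2}(size l) (leqnn (size l)) => n.
elim: n l f x => [|n ih] l f x.
  by rewrite leqn0 => /nilP -> _ _ _ /=; rewrite (ipxx norm_dot).
case/lastP: l => [|l e] szl sub fcd Ax; first by rewrite /= (ipxx norm_dot).
rewrite size_rcons ltnS in szl.
have subl : {subset l <= [:: c; d]}.
  by move=> i il; apply: sub; rewrite mem_rcons inE il orbT.
have ecd : e \in [:: c; d] by apply: sub; rewrite mem_rcons inE eqxx.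
have sq u : nrm (P (A e) u) ^+ 2 <= nrm u ^+ 2.
  by rewrite ler_pXn2r ?nnegrE ?nrm_ge0 // (nrm_proj_le norm_dot (cA e)).
(* A last letter f moves to the left side of the inner product, where it fixes x. *)
have [ef|ef] := eqVneq e f.
  rewrite foldl_rcons; apply: le_trans (sq _) _.
  rewrite -(ip_proj norm_dot (cA e)) (orth_proj_id norm_dot (cA e)) ?ef //.
  exact: (ih l f).
case: l szl subl sub => [|i l] szl subl sub.
  rewrite /= -{2}(orth_proj_id norm_dot (cA e) (orth_proj_in norm_dot (cA e) x)).
  by rewrite -(ip_proj norm_dot (cA e)) (ipxx norm_dot).
have [ifq|ifq] := eqVneq i f.
  rewrite rcons_cons /= {1 2}ifq (orth_proj_id norm_dot (cA f)) //.
  apply: (ih _ f) => //; first by rewrite size_rcons.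
  by move=> j jl; apply: sub; rewrite rcons_cons inE jl orbT.
(* Otherwise the word begins and ends with the other letter e, and the induction hypothesis applies
   to the inner word at P_e x. *)
have ie : i = e.
  have : i \in [:: c; d] by apply: subl; rewrite inE eqxx.
  by move=> icd; move: icd ecd fcd ef ifq; rewrite !inE; do 3!(case/orP=> /eqP ->); rewrite ?eqxx.
rewrite foldl_rcons; apply: le_trans (sq _) _.
rewrite -(ip_proj norm_dot (cA e)) /= ie.
apply: (ih l e) => //; first exact: ltnW.
  by move=> j jl; apply: subl; rewrite inE jl orbT.
exact: (orth_proj_in norm_dot (cA e)).
Qed.

Lemma two_letter_displacement (c d : 'I_K) (l : seq 'I_K) f x :
  {subset l <= [:: c; d]} -> f \in [:: c; d] -> A f x ->
  nrm (x - W x l) ^+ 2 <= nrm x ^+ 2 - nrm (W x l) ^+ 2.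
Proof.
move=> sub fcd Ax; rewrite (nrm_sqB norm_dot).
by have := two_letter_word sub fcd Ax; lra.
Qed.

Lemma proj_iteratesD (k : nat -> 'I_K) z n m :
  proj_iterates dot A k z (n + m) =
  W (proj_iterates dot A k z n) [seq k i | i <- iota n m].
Proof.
elim: m => [|m ih]; first by rewrite addn0.
by rewrite addnS -[in RHS]addn1 iotaD map_cat foldl_cat -ih.
Qed.

End Words.

(** The norms decrease, so a single small iterate suffices. If there is none, the losses of squared
    norm become small, and some z_n is close to a point of each [Lk j], against regularity. *)
Lemma innate_regularity (A : 'I_K -> set H) (k : nat -> 'I_K) z0 :
  (1 < K)%N ->
  (forall a b : 'I_K, a != b -> exists c d, forall j, j \in [:: a; b; c; d]) ->
  (forall j, closed_subspace (A j)) -> (forall j, A j `<=` Lk j `&` M) ->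
  (forall j N, exists2 n, (N <= n)%N & k n = j) ->
  regular M -> cvgn (proj_iterates dot A k z0).
Proof.
move=> K1 hcd cA AL hk [c c0 hc].
set z := proj_iterates dot A k z0.
have zS n : z n.+1 = P (A (k n)) (z n) by [].
have zA n : A (k n) (z n.+1) by rewrite zS; exact: (orth_proj_in norm_dot (cA _)).
have zle n m : (n <= m)%N -> nrm (z m) <= nrm (z n).
  elim: m => [|m ih]; first by rewrite leqn0 => /eqP ->.
  rewrite leq_eqVlt => /orP[/eqP -> //|/ih h].
  by apply: le_trans h; rewrite zS (nrm_proj_le norm_dot (cA _)).
suff small (e : R) : 0 < e -> exists N, nrm (z N) < e.
  apply: nrm_cvg0 => e /small [N hN]; exists N => n Nn.
  exact: le_lt_trans (zle _ _ Nn) hN.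
move=> e0; apply: contrapT => hz.
have {}hz n : e <= nrm (z n) by rewrite leNgt; apply/negP => h; apply: hz; exists n.
(* Chosen so that K defects of at most 2 eta add up to less than c e. *)
pose eta := c * e / (2 * K%:R + 1).
have Kp : 0 < 2 * K%:R + 1 :> R by rewrite ltr_wpDl // mulr_ge0.
have eta0 : 0 < eta by rewrite divr_gt0 // mulr_gt0.
have [N hN] : exists N, forall n, (N <= n)%N -> nrm (z N) ^+ 2 - nrm (z n) ^+ 2 <= eta ^+ 2.
  pose E := [set nrm (z n) ^+ 2 | n in setT].
  have E0 : has_inf E.
    split; first by exists (nrm (z 0%N) ^+ 2), 0%N.
    by exists 0 => _ [n _ <-]; exact: sqr_ge0.
  have [_ [N _ <-] h] := inf_adherent (exprn_gt0 2 eta0) E0.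
  exists N => n _.
  have : inf E <= nrm (z n) ^+ 2 by apply: ge_inf; [case: E0|exists n].
  by move: h; lra.
have drop m n : (N <= m)%N -> (m <= n)%N -> nrm (z m) ^+ 2 - nrm (z n) ^+ 2 <= eta ^+ 2.
  move=> Nm mn; apply: le_trans (hN n (leq_trans Nm mn)).
  by rewrite lerD2r ler_pXn2r ?nnegrE ?nrm_ge0 // zle.
have step m : (N <= m)%N -> nrm (z m - z m.+1) <= eta.
  move=> Nm; apply: nrm_le_sq; first exact: ltW.
  have := nrm_proj_sq norm_dot (cA (k m)) (z m); rewrite -zS.
  by have := drop m m.+1 Nm (leqnSn m); lra.
have fex j : exists n, (N <= n)%N && (k n == j).
  by have [n Nn kn] := hk j N; exists n; rewrite Nn kn eqxx.
pose f j := ex_minn (fex j).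
have fP j : [/\ (N <= f j)%N, k (f j) = j & forall m, (N <= m)%N -> k m = j -> (f j <= m)%N].
  rewrite /f; case: ex_minnP => m /andP[Nm /eqP km] hm; split => // m' Nm' km'.
  by apply: hm; rewrite Nm' km' eqxx.
pose o : 'I_K := Ordinal (ltnW K1).
(* The letter whose first occurrence after N comes last, at time n: all other letters occur between
   N and n. *)
pose a := [arg max_(i > o) f i].
have ha j : (f j <= f a)%N by rewrite /a; case: arg_maxnP => // i _; apply.
set n := f a in ha.
have [Nn kn fa] := fP a; rewrite -/n in Nn kn fa.
have fjn j : j != a -> (f j < n)%N.
  move=> ja; rewrite ltn_neqAle ha andbT; apply: contra ja => /eqP fj.
  by have [_ <- _] := fP j; rewrite fj kn.
have /choice [g hg] : forall j, exists m, j != a -> [/\ (N <= m < n)%N, k m = j &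
    forall m', (m < m' < n)%N -> k m' != j].
  move=> j; have [->|ja] := eqVneq j a; first by exists 0%N.
  have ex : exists m, [&& (N <= m)%N, (m < n)%N & k m == j].
    by exists (f j); have [-> -> _] := fP j; rewrite fjn ?eqxx.
  have bd m : [&& (N <= m)%N, (m < n)%N & k m == j] -> (m <= n)%N.
    by case/and3P => _ /ltnW.
  case: (ex_maxnP ex bd) => m /and3P[Nm mn /eqP km] hm; exists m => _; split => //.
    by rewrite Nm.
  move=> m' /andP[mm' m'n]; apply/negP => /eqP km'.
  by have := hm m'; rewrite km' eqxx m'n (leq_trans Nm (ltnW mm')) leqNgt mm' => /(_ isT).
have [b0 b0a] : exists b0 : 'I_K, b0 != a.
  have [->|] := eqVneq a o; last by rewrite eq_sym; exists o.
  by exists (Ordinal K1); rewrite -val_eqE.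
(* The letter whose last occurrence t before n is the earliest. Between t and n neither a nor b
   occurs, and every letter other than a and b does. *)
pose b := [arg min_(i < b0 | i != a) g i].
have [ba hb] : b != a /\ forall j, j != a -> (g b <= g j)%N.
  by rewrite /b; case: arg_minnP.
set t := g b in hb.
have [/andP[Nt tn] kt tb] := hg b ba; rewrite -/t in Nt tn kt tb.
have ab : a != b by rewrite eq_sym.
have [c1 [d1 hcd1]] := hcd a b ab.
have letters m : (t < m < n)%N -> k m \in [:: c1; d1].
  move=> tmn; have := hcd1 (k m); rewrite inE [_ \in [:: b, c1 & _]]inE.
  rewrite (negbTE (tb m tmn)) /=; case/andP: tmn => tm mn.
  case: eqP => [kma|_] //= _.
  by have := fa m (leq_trans Nt (ltnW tm)) kma; rewrite leqNgt mn.
(* The start is t + 2 since the word estimate needs a point in the space of one of the two remaining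
   letters; z_(t+1) lies in that of b. *)
have near i : (t.+1 < i)%N -> (i <= n)%N -> nrm (z t.+2 - z i) <= eta.
  move=> ti i_n; apply: nrm_le_sq; first exact: ltW.
  apply: le_trans (drop t.+2 i (leqW (leqW Nt)) ti).
  have -> : z i = foldl (fun y k => P (A k) y) (z t.+2) [seq k j | j <- iota t.+2 (i - t.+2)].
    by rewrite -proj_iteratesD subnKC.
  apply: (@two_letter_displacement A cA c1 d1 _ (k t.+1)) => //.
    move=> _ /mapP[j + ->]; rewrite mem_iota subnKC // => /andP[tj ji].
    by apply: letters; rewrite (leq_trans _ (ltnW tj)) //= (leq_trans ji).
  by apply: letters; rewrite leqnn (leq_trans ti).
have close i : (t < i <= n)%N -> nrm (z n - z i) <= 2 * eta.
  case/andP => ti i_n.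
  have [tn1|tn1] := ltnP t.+1 n; last first.
    have -> : i = n by apply/eqP; rewrite eqn_leq i_n (leq_trans tn1).
    by rewrite subrr nrm0 mulr_ge0 // ltW.
  have h1 := near n tn1 (leqnn _).
  move: ti; rewrite leq_eqVlt => /orP[/eqP <-|ti].
    have := step t.+1 (leqW Nt); have := nrm_tri (z t.+2) (z n) (z t.+1).
    rewrite (nrmB (z n) (z t.+2)) (nrmB (z t.+2) (z t.+1)); lra.
  have := near i ti i_n; have := nrm_tri (z t.+2) (z n) (z i).
  rewrite (nrmB (z n) (z t.+2)); lra.
have dj j : defect j (z n) <= 2 * eta.
  have [->|ja] := eqVneq j a.
    apply: (@le_trans _ _ (nrm (z n - z n.+1))).
      by apply: (defect_le norm_dot cL); rewrite -kn; case: (AL (k n) _ (zA n)).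
    by have := step n Nn; lra.
  have [/andP[Ng gn] kg _] := hg j ja.
  apply: (@le_trans _ _ (nrm (z n - z (g j).+1))).
    by apply: (defect_le norm_dot cL); have := zA (g j); rewrite kg => /AL[].
  by apply: close; rewrite ltnS (hb j ja).
have Mzn : M (z n).
  have : (0 < n)%N by apply: leq_ltn_trans tn.
  by case: (n) => // n' _; case: (AL _ _ (zA n')).
have : c * e <= K%:R * (2 * eta).
  apply: (@le_trans _ _ (c * nrm (z n))); first by rewrite ler_pM2l.
  apply: le_trans (hc _ Mzn) _.
  apply: (@le_trans _ _ (\sum_(j < K) (2 * eta))); first exact: ler_sum.
  by rewrite sumr_const card_ord -[leLHS]mulr_natl.
have -> : c * e = eta * (2 * K%:R + 1) by rewrite divfK // gt_eqF.
by rewrite leNgt => /negP; apply; rewrite mulrDr mulr1 mulrA mulrC [_ * 2]mulrC ltrDl.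
Qed.
End RandomProducts.

(** * Parameters of the divergent product *)

Section Exponents.
Local Open Scope nat_scope.

(* Step (n, j) turns the vector in the plane of w_(n-1) and w_n; its weight d is
   4^-(weight_exp n j) and the eigenvalue of X Y X at its basis vector is about
   1 - 2^-(tilt_exp n j). The basis vectors are killed in the order of [kill_rank], which
   visits the stages in the order 0, 2, 1, 4, 3, 6, 5, ...: when an even stage is processed,
   the two stages that share a vector of W with it are still intact; when an odd stage is
   processed, they have been killed, but with much smaller weights. If the stages were killed
   in their natural order, the weights would have to increase forever. *)
Definition steps n := 2 ^ (n + 6).

(** Within a stage the exponents decrease by a factor 3 per step, and those of an even stage exceed
    three times those of the adjacent odd stages. *)
Definition weight_exp n j :=
  if odd n then (5 * n + 50) * 3 ^ (steps n - j)
  else (5 * n.+1 + 50) * 3 ^ (2 * steps n.+1 + 1 - j).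

Definition stage_rank n := if odd n then n.+2 else n.
(** The powers of two separate the stages into disjoint blocks, which makes the order lexicographic
    in ([stage_rank], j). *)
Definition kill_rank n j := 2 ^ (stage_rank n + 7) + j.

Definition slack n j := 4 * weight_exp n j + 10 * n + 83.

(** Passing from rank r to r + 1 adds the slack of every step with indices at most r, in particular
    that of the step killed at rank r. *)
Definition tilt_sum r := \sum_(t < r) \sum_(n < t.+1) \sum_(j < t.+1) slack n j.
Definition tilt_exp n j := tilt_sum (kill_rank n j).
Definition error_exp n := \sum_(N < n.+1) \sum_(j < steps N.+1) (tilt_exp N.+1 j + slack N.+1 j).

Lemma leq_sum_ord (m i : nat) (f : nat -> nat) : i < m -> f i <= \sum_(j < m) f j.
Proof. by move=> im; rewrite (bigD1 (Ordinal im)) //= leq_addr. Qed.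

Lemma weight_exp_ge n j : 5 * n + 50 <= weight_exp n j.
Proof.
rewrite /weight_exp; case: odd; first by rewrite leq_pmulr // expn_gt0.
apply: (@leq_trans (5 * n.+1 + 50)); first by lia.
by rewrite leq_pmulr // expn_gt0.
Qed.

Lemma tilt_sum_lt r r' n j : n <= r -> j <= r -> r < r' ->
  tilt_sum r + slack n j <= tilt_sum r'.
Proof.
move=> nr jr rr'; have h : tilt_sum r + slack n j <= tilt_sum r.+1.
  rewrite /tilt_sum big_ord_recr /= leq_add2l.
  apply: leq_trans (leq_sum_ord (fun n => \sum_(j < r.+1) slack n j) (i := n) _); last by [].
  exact: (leq_sum_ord (fun j => slack n j)).
apply: leq_trans h _.
by rewrite /tilt_sum -(subnKC rr') big_split_ord /= leq_addr.
Qed.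

Lemma leq_steps m n : m <= n -> steps m <= steps n.
Proof. by move=> mn; rewrite leq_exp2l // leq_add2r. Qed.

Lemma rank_ge n j : n <= kill_rank n j /\ j <= kill_rank n j.
Proof.
rewrite leq_addl; split=> //; apply: leq_trans (leq_addr _ _).
apply: (@leq_trans (stage_rank n + 7)); first by rewrite /stage_rank; case: odd; lia.
exact: ltnW (ltn_expl _ _).
Qed.

Lemma ltn_rank n i n' j : stage_rank n < stage_rank n' -> i < steps n ->
  kill_rank n i < kill_rank n' j.
Proof.
move=> nn' i_n; have h : steps n <= 2 ^ (stage_rank n + 7).
  by rewrite leq_exp2l // /stage_rank; case: odd; lia.
have : 2 ^ (stage_rank n + 8) <= 2 ^ (stage_rank n' + 7) by rewrite leq_exp2l //; lia.
rewrite addnS expnS /kill_rank; lia.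
Qed.

(** Within one stage a smaller rank means i < j. Between adjacent stages the even one is killed
    first, so N is odd and n is even. *)
Lemma weight_exp_gap N j n i : j < steps N -> i < steps n -> n <= N.+1 -> N <= n.+1 ->
  (n, i) != (N, j) -> kill_rank n i <= kill_rank N j -> 3 * weight_exp N j <= weight_exp n i.
Proof.
move=> jN i_n nN Nn neq rk; have [nNe|nNe] := eqVneq n N.
  subst n; have ij : i < j.
    by move: neq rk; rewrite xpair_eqE eqxx /= /kill_rank; lia.
  have p3 a b : b < a -> 3 * 3 ^ b <= 3 ^ a by move=> ba; rewrite -expnS leq_exp2l.
  rewrite /weight_exp; case: ifP => _.
    by rewrite mulnCA leq_mul // p3 //; lia.
  have := leq_steps (leqnSn N) => h.
  by rewrite mulnCA leq_mul // p3 //; lia.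
have [No|Ne] := boolP (odd N); last first.
  have : kill_rank N j < kill_rank n i.
    apply: ltn_rank => //; rewrite /stage_rank (negbTE Ne).
    have -> : odd n; last by lia.
    have : n = N.+1 \/ N = n.+1 by lia.
    by case=> e; move: Ne; rewrite e //= negbK.
  by rewrite ltnNge rk.
have ne : ~~ odd n.
  have : n = N.+1 \/ N = n.+1 by lia.
  by case=> e; move: No; rewrite e /= ?negbK.
rewrite /weight_exp No (negbTE ne).
have h1 := leq_steps Nn; have h2 := leq_steps (leqnSn n).
rewrite mulnCA leq_mul ?leq_add2r ?leq_mul2l //.
by rewrite -expnS leq_exp2l //; lia.
Qed.

(** 2^-X is the error tolerated in step (N+1, j). A neighbouring step killed earlier has negligible
    weight at this scale; one killed later has negligible tilt. *)
Lemma exponents N j n : j < steps N.+1 -> N <= n <= N.+2 ->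
  let X := 2 * weight_exp N.+1 j + 5 * N + 41 in
  tilt_exp N.+1 j + 2 * X + 1 <= error_exp n /\
  forall i, i < steps n -> (n, i) != (N.+1, j) ->
    X + 1 <= weight_exp n i \/ tilt_exp N.+1 j + 2 * X + 1 <= tilt_exp n i.
Proof.
move=> jN /andP[Nn nN] X.
have hX : 2 * X + 1 <= slack N.+1 j by rewrite /X /slack; lia.
have [r1 r2] := rank_ge N.+1 j.
split.
  apply: (@leq_trans (tilt_exp N.+1 j + slack N.+1 j)); first by rewrite -addnA leq_add2l.
  apply: leq_trans (leq_sum_ord (fun N => \sum_(j < steps N.+1) (tilt_exp N.+1 j + slack N.+1 j)) (i := N) _); last by rewrite ltnS.
  exact: (leq_sum_ord (fun j => tilt_exp N.+1 j + slack N.+1 j)).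
move=> i i_n neq; case: (leqP (kill_rank n i) (kill_rank N.+1 j)) => rk.
  left; have := weight_exp_gap jN i_n nN Nn neq rk; have := weight_exp_ge N.+1 j.
  rewrite /X; lia.
right; apply: leq_trans (tilt_sum_lt r1 r2 rk).
by rewrite -addnA leq_add2l.
Qed.

End Exponents.

(** * Weights, tilts and errors as powers of one half *)

Section RealParameters.
Context (R : realType).
Local Notation half := (2^-1 : R).

Lemma half_gt0 n : 0 < half ^+ n.
Proof. by rewrite exprn_gt0 // invr_gt0. Qed.
Lemma half_le1 n : half ^+ n <= 1.
Proof. by rewrite exprn_ile1 // ?invr_ge0 // invf_le1 // ler1n. Qed.
Lemma ler_half m n : (m <= n)%N -> half ^+ n <= half ^+ m.
Proof.
by move=> mn; apply: ler_wiXn2l; rewrite ?invr_ge0 // invf_le1 // ler1n.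
Qed.
Lemma ler_pow2_half a b c : (a + c <= b)%N -> (2 ^ a)%:R * half ^+ b <= half ^+ c.
Proof.
move=> h; apply: (@le_trans _ _ ((2 ^ a)%:R * half ^+ (a + c))).
  by rewrite ler_wpM2l // ler_half.
by rewrite exprD mulrA natrX -exprMn mulfV // expr1n mul1r.
Qed.

Lemma one_sub_exp (x : R) n : 0 <= x <= 1 -> (1 - x) ^+ n * (1 + n%:R * x) <= 1.
Proof.
move=> /andP[x0 x1]; elim: n => [|n ih]; first by rewrite expr0 mul0r addr0 mulr1.
rewrite exprS; have p0 : 0 <= (1 - x) ^+ n by rewrite exprn_ge0 // subr_ge0.
rewrite -natr1 -mulrA mulrCA; apply: le_trans ih; rewrite ler_wpM2l //.
have : 0 <= n%:R :> R by []. nra.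
Qed.

Lemma one_sub_half_exp a b : (b <= a)%N ->
  (1 - half ^+ b) ^+ (2 ^ a) <= half ^+ (a - b).
Proof.
move=> ba; have h01 : 0 <= half ^+ b <= 1 by rewrite ltW ?half_gt0 // half_le1.
have := one_sub_exp (2 ^ a) h01.
set y := (1 - _) ^+ _; have y0 : 0 <= y by rewrite exprn_ge0 // subr_ge0 half_le1.
have -> : (2 ^ a)%:R * half ^+ b = (half ^+ (a - b))^-1.
  rewrite -{1}(subnK ba) expnD natrM -mulrA 2!natrX -exprMn mulfV // expr1n mulr1.
  by rewrite -exprVn invrK.
set z := half ^+ (a - b); have z0 : 0 < z := half_gt0 _.
move=> h; rewrite -[z]mul1r -ler_pdivrMr //; nra.
Qed.

(** The value at j = [steps n] completes the sum of squares of a stage to 1/2; each w_N is spread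
    over two stages and so becomes a unit vector. *)
Definition weight n j : R :=
  if (j < steps n)%N then half ^+ weight_exp n j
  else Num.sqrt (half - \sum_(i < steps n) (half ^+ weight_exp n i) ^+ 2).
Definition tilt n j : R := if (j < steps n)%N then half ^+ tilt_exp n j else 0.
Definition closeness n : R := half ^+ error_exp n.

Lemma sum_weight_lt n :
  \sum_(i < steps n) (half ^+ weight_exp n i) ^+ 2 <= half.
Proof.
apply: (@le_trans _ _ (\sum_(i < steps n) half ^+ (n + 7))).
  apply: ler_sum => i _; rewrite -exprM ler_half //.
  by have := weight_exp_ge n i; lia.
rewrite sumr_const card_ord -[leLHS]mulr_natl -[leRHS]expr1.
by apply: (@ler_pow2_half (n + 6)); lia.
Qed.

Lemma weight_ge0 n j : 0 <= weight n j.
Proof. by rewrite /weight; case: ifP => _; rewrite ?sqrtr_ge0 // ltW ?half_gt0. Qed.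

Lemma sum_weight n : \sum_(i < (steps n).+1) weight n i ^+ 2 = half.
Proof.
rewrite big_ord_recr /= {2}/weight ltnn sqr_sqrtr ?subr_ge0 ?sum_weight_lt //.
rewrite addrC -[RHS](subrK (\sum_(i < steps n) (half ^+ weight_exp n i) ^+ 2)).
by congr (_ + _); apply: eq_bigr => i _; rewrite /weight ltn_ord.
Qed.

Lemma weight_le1 n j : weight n j <= 1.
Proof.
rewrite /weight; case: ifP => _; first exact: half_le1.
rewrite -[leRHS]sqrtr1 ler_sqrt //.
have : 0 <= \sum_(i < steps n) (half ^+ weight_exp n i) ^+ 2.
  by apply: sumr_ge0 => i _; exact: sqr_ge0.
by have : half <= 1; [rewrite invf_le1 // ler1n|lra].
Qed.

Lemma tilt_ge0 n j : 0 <= tilt n j.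
Proof. by rewrite /tilt; case: ifP => // _; rewrite ltW ?half_gt0. Qed.
Lemma tilt_le1 n j : tilt n j <= 1.
Proof. by rewrite /tilt; case: ifP => // _; exact: half_le1. Qed.
Lemma closeness_gt0 n : 0 < closeness n.
Proof. exact: half_gt0. Qed.
Lemma closeness_le1 n : closeness n <= 1.
Proof. exact: half_le1. Qed.

Lemma parameters N j : (j < steps N.+1)%N -> exists (m p : nat) (x : R),
  [/\ [/\ 0 < x, (1 - weight N.+1 j ^+ 2) ^+ m <= half ^+ (2 * N + 13) &
        m%:R * (2 ^ (N + 15))%:R * x <= half ^+ (2 * N + 13)],
      forall n, (N <= n <= N.+2)%N -> closeness n <= x /\ p%:R * closeness n <= x,
      forall n i, (N <= n <= N.+2)%N -> (n, i) != (N.+1, j) ->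
        2 * weight n i <= x \/ p%:R * (tilt n i + closeness n) <= x &
      (1 - tilt N.+1 j) ^+ p <= x].
Proof.
move=> jN; pose E := weight_exp N.+1 j; pose t := (2 * N + 13)%N.
pose X := (2 * E + 5 * N + 41)%N; pose V := tilt_exp N.+1 j.
(* p = 2^(V+X) powers kill a vector of tilt 2^-V up to 2^-X, and m = 2^(2E+t) rounds shrink the
   component along q, which loses the factor 1 - 2^(-2E) each time, to 2^-t. *)
exists (2 ^ (2 * E + t))%N, (2 ^ (V + X))%N, (half ^+ X).
have hexp n (hn : (N <= n <= N.+2)%N) := exponents jN hn.
have hc n : (N <= n <= N.+2)%N -> (2 ^ (V + X))%:R * closeness n <= half ^+ X.+1.
  by move=> /hexp[h _]; apply: ler_pow2_half; move: h; rewrite -/V -/E /X; lia.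
have hX : half ^+ X.+1 <= half ^+ X by rewrite ler_half.
split.
- split; first exact: half_gt0.
    rewrite /weight jN -exprM mulnC; apply: le_trans (one_sub_half_exp _) _.
      by rewrite leq_addr.
    by rewrite ler_half // -/E addKn.
  rewrite -natrM -expnD; apply: ler_pow2_half; rewrite /X /t; lia.
- move=> n hn; split; last exact: le_trans (hc n hn) hX.
  apply: le_trans hX; apply: le_trans (hc n hn).
  by rewrite ler_peMl ?(ltW (closeness_gt0 _)) // ler1n expn_gt0.
- move=> n i hn neq; have [i_n|i_n] := ltnP i (steps n); last first.
    right; rewrite /tilt ltnNge i_n /= add0r; exact: le_trans (hc n hn) hX.
  have [_ /(_ i i_n neq) [h|h]] := hexp n hn.
    by left; rewrite /weight i_n; apply: (@ler_pow2_half 1); move: h; rewrite -/E /X; lia.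
  right; rewrite mulrDr; apply: (@le_trans _ _ (half ^+ X.+1 + half ^+ X.+1)).
    rewrite lerD ?hc // /tilt i_n; apply: ler_pow2_half; move: h.
    by rewrite -/V -/E /X; lia.
  by rewrite exprS; lra.
- rewrite /tilt jN; apply: le_trans (one_sub_half_exp _) _; first by rewrite leq_addr.
  by rewrite ler_half // -/V addKn.
Qed.
End RealParameters.

(** * A quarter circle divided into small steps *)

Section Rotation.
Context (R : realType).
Implicit Types (n j : nat) (al be : R).

(** The positions ([posC], [posS]) are equidistant points of the chord from (1,0) to (0,1),
    normalised; this avoids trigonometry. *)
Definition pos_norm n j : R := Num.sqrt ((steps n - j)%:R ^+ 2 + j%:R ^+ 2).
Definition posC n j : R := (steps n - j)%:R / pos_norm n j.
Definition posS n j : R := j%:R / pos_norm n j.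

Lemma steps_gt0 n : (0 < steps n)%N.
Proof. by rewrite expn_gt0. Qed.

Lemma pos_norm_sq n j : pos_norm n j ^+ 2 = (steps n - j)%:R ^+ 2 + j%:R ^+ 2.
Proof. by rewrite sqr_sqrtr // addr_ge0 ?sqr_ge0. Qed.

Lemma pos_norm_gt0 n j : 0 < pos_norm n j.
Proof.
rewrite sqrtr_gt0; have [->|j0] := posnP j.
  by rewrite subn0 ltr_pwDl ?sqr_ge0 // exprn_gt0 // ltr0n steps_gt0.
by rewrite ltr_wpDl ?sqr_ge0 // exprn_gt0 // ltr0n.
Qed.

Lemma pos_unit n j : posC n j ^+ 2 + posS n j ^+ 2 = 1.
Proof.
rewrite !expr_div_n -mulrDl pos_norm_sq divff //.
by rewrite -pos_norm_sq expf_neq0 // gt_eqF // pos_norm_gt0.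
Qed.

Lemma pos0 n : posC n 0 = 1 /\ posS n 0 = 0.
Proof.
have h : pos_norm n 0 = (steps n)%:R.
  by rewrite /pos_norm subn0 expr0n addr0 sqrtr_sqr ger0_norm.
rewrite /posC /posS h subn0 mul0r divff //.
by rewrite pnatr_eq0 -lt0n steps_gt0.
Qed.

Lemma pos_last n : posC n (steps n) = 0 /\ posS n (steps n) = 1.
Proof.
have h : pos_norm n (steps n) = (steps n)%:R.
  by rewrite /pos_norm subnn expr0n add0r sqrtr_sqr ger0_norm.
rewrite /posC /posS h subnn mul0r divff //.
by rewrite pnatr_eq0 -lt0n steps_gt0.
Qed.

(** For k = [steps n], consecutive points of the unscaled chord have determinant k and norms at
    least k / sqrt 2. So the squared sine of their angle is at most 4 / k^2, and 1 - c <= 1 - c^2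
    for the cosine c. *)
Lemma pos_close n j : (j < steps n)%N ->
  1 - (posC n j * posC n j.+1 + posS n j * posS n j.+1) <= 4 / (steps n)%:R ^+ 2.
Proof.
move=> jn; set k : R := (steps n)%:R; set x : R := j%:R.
have k0 : 0 < k by rewrite ltr0n steps_gt0.
have e1 : (steps n - j)%:R = k - x by rewrite natrB // ltnW.
have e2 : (steps n - j.+1)%:R = k - (x + 1) by rewrite natrB // natr1.
have x0 : 0 <= x by [].
have xk : x + 1 <= k by rewrite /k /x natr1 ler_nat.
have := pos_norm_sq n j; have := pos_norm_sq n j.+1.
have := pos_norm_gt0 n j; have := pos_norm_gt0 n j.+1.
rewrite /posC /posS e1 e2 -/x -natr1 -/x.
set a := pos_norm n j; set b := pos_norm n j.+1 => b0 a0 hb ha.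
have k20 : 0 < k ^+ 2 by rewrite exprn_gt0.
set c := _ / a * _ + _.
have abp : 0 < a * b by rewrite mulr_gt0.
have ec : c * (a * b) = (k - x) * (k - (x + 1)) + x * (x + 1).
  by rewrite /c; field; rewrite !gt_eqF.
have c0 : 0 <= c.
  by rewrite -(pmulr_lge0 _ abp) ec addr_ge0 // mulr_ge0 // ?subr_ge0 //; lra.
have det : (1 - c ^+ 2) * (a ^+ 2 * b ^+ 2) = k ^+ 2.
  have -> : (1 - c ^+ 2) * (a ^+ 2 * b ^+ 2) = a ^+ 2 * b ^+ 2 - (c * (a * b)) ^+ 2 by ring.
  by rewrite ec ha hb; ring.
have la : k ^+ 2 <= 2 * a ^+ 2 by rewrite ha; have := sqr_ge0 (k - 2 * x); nra.
have lb : k ^+ 2 <= 2 * b ^+ 2 by rewrite hb; have := sqr_ge0 (k - 2 * (x + 1)); nra.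
have ab4 : k ^+ 2 * k ^+ 2 <= 4 * (a ^+ 2 * b ^+ 2).
  have -> : 4 * (a ^+ 2 * b ^+ 2) = (2 * a ^+ 2) * (2 * b ^+ 2) by ring.
  by rewrite ler_pM // ltW.
have c1 : c <= 1.
  rewrite -(@ler_pXn2r _ 2) ?nnegrE // expr1n -subr_ge0.
  have p : 0 < a ^+ 2 * b ^+ 2 by rewrite mulr_gt0 ?exprn_gt0.
  by rewrite -(pmulr_lge0 _ p) det ltW.
have h2 : (1 - c ^+ 2) * k ^+ 2 <= 4.
  rewrite -(ler_pM2r k20) -mulrA -det; set d := 1 - c ^+ 2 in det *.
  have d0 : 0 <= d by rewrite /d subr_ge0 expr_le1.
  by have := ler_wpM2l d0 ab4; rewrite det; lra.
rewrite ler_pdivlMr //; apply: le_trans h2; rewrite ler_wpM2r ?(ltW k20) //.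
rewrite lerD2l lerN2 expr2; exact: ler_piMl.
Qed.

(** Coordinates of (al, be) in the orthonormal frame of position j + 1, the target of step j: along
    the target for [true], along the orthogonal direction q for [false]. *)
Definition frame_coord n j (bit : bool) al be : R :=
  if bit then posC n j.+1 * al + posS n j.+1 * be
  else posC n j.+1 * be - posS n j.+1 * al.

Lemma frame_coordD n j bit al be al' be' :
  frame_coord n j bit (al + al') (be + be') = frame_coord n j bit al be + frame_coord n j bit al' be'.
Proof. by rewrite /frame_coord; case: bit; ring. Qed.

Lemma frame_coordZ n j bit r al be : frame_coord n j bit (r * al) (r * be) = r * frame_coord n j bit al be.
Proof. by rewrite /frame_coord; case: bit; ring. Qed.

Lemma frame_coord_dot n j al be al' be' :
  \sum_(bit : bool) frame_coord n j bit al be * frame_coord n j bit al' be' = al * al' + be * be'.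
Proof.
rewrite big_bool /frame_coord /= -[RHS]mul1r -(pos_unit n j.+1); ring.
Qed.

Lemma frame_coord_le n j bit al be : al ^+ 2 + be ^+ 2 <= 1 -> `|frame_coord n j bit al be| <= 1.
Proof.
move=> h; rewrite -(@ler_pXn2r _ 2) ?nnegrE // expr1n real_normK ?num_real //.
apply: le_trans h; have := frame_coord_dot n j al be al be; rewrite big_bool -!expr2 /= => <-.
by case: bit; rewrite ?lerDl ?lerDr sqr_ge0.
Qed.

End Rotation.

(** * A divergent product of projections *)

Lemma concat_words (T : eqType) (x0 : T) (u : nat -> seq T) :
  (forall n, u n != [::]) ->
  exists k : nat -> T,
    (forall N, let v := flatten [seq u i | i <- iota 0 N] in
       [seq k i | i <- iota 0 (size v)] = v) /\
    (forall j, (forall n, j \in u n) -> forall N, exists2 n, (N <= n)%N & k n = j).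
Proof.
move=> u0; pose v N := flatten [seq u i | i <- iota 0 N].
have vS N : v N.+1 = v N ++ u N.
  by rewrite /v -addn1 iotaD map_cat flatten_cat /= cats0.
have szv N : (N <= size (v N))%N.
  elim: N => // N ih; rewrite vS size_cat -addn1 leq_add // lt0n size_eq0; exact: u0.
have vnth N M i : (N <= M)%N -> (i < size (v N))%N -> nth x0 (v M) i = nth x0 (v N) i.
  move=> NM iN; elim: M NM => [|M ih]; first by rewrite leqn0 => /eqP <-.
  rewrite leq_eqVlt => /orP[/eqP <- //|NM]; rewrite vS nth_cat.
  suff -> : (i < size (v M))%N by exact: ih.
  elim: M NM {ih} => [|M ih]; first by rewrite ltnS leqn0 => /eqP <-.
  rewrite ltnS leq_eqVlt => /orP[/eqP <- //|NM].
  by apply: leq_trans (ih NM) _; rewrite vS size_cat leq_addr.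
(* The words are nonempty, so i + 1 of them already contain the letter at position i. *)
pose k i := nth x0 (v i.+1) i.
have kv N i : (i < size (v N))%N -> k i = nth x0 (v N) i.
  move=> iN; have [Ni|iN'] := leqP N i.+1; first exact: vnth.
  by rewrite /k -(vnth i.+1 N) // ltnW.
exists k; split=> [N /=|j hj N].
  rewrite -/(v N); apply: (@eq_from_nth _ x0); rewrite size_map size_iota // => i iN.
  by rewrite (nth_map 0%N) ?size_iota // nth_iota // add0n (kv N).
exists (size (v N) + index j (u N))%N; first by rewrite (leq_trans (szv N)) ?leq_addr.
rewrite (kv N.+1); last by rewrite vS size_cat ltn_add2l index_mem.
by rewrite vS nth_cat ltnNge leq_addr /= addKn nth_index.
Qed.

(** * Closed linear spans *)

Section Span.
Context (R : realType) (s : scalar_kind).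
Context (H : completeNormedModType (scalars R s)).
Context (dot : {dot H for @scalar_conj R s}).
Hypothesis norm_dot : forall x : H, `|x| ^+ 2 = dot x x.
Local Notation F := (scalars R s).
Local Notation orthocomp := (orthocomp dot).
Local Notation P := (orth_proj dot).
Implicit Types (x y z : H) (a b : F) (r t : R).

(** The closed linear span, as a double orthogonal complement. *)
Definition cl_span (S : set H) := orthocomp (orthocomp S).

Lemma closed_cl_span S : closed_subspace (cl_span S).
Proof. exact: (orthocomp_closed norm_dot). Qed.
Lemma sub_cl_span S : S `<=` cl_span S.
Proof. exact: sub_orthocomp2. Qed.
Lemma cl_span_sub S X : closed_subspace X -> S `<=` X -> cl_span S `<=` X.
Proof.
move=> cX SX; apply: subset_trans (orthocomp2 norm_dot cX).
by do 2!apply: orthocompS.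
Qed.
Lemma proj_cl_span S x y : cl_span S y -> (forall z, S z -> dot (x - y) z = 0) ->
  P (cl_span S) x = y.
Proof.
move=> Sy h; apply: (orth_proj_uniq norm_dot (closed_cl_span S) Sy) => z hz.
by apply: dot_eq0C; exact: hz.
Qed.

Lemma proj_cl_span_orthonormal I (o : I -> H) (i : I) x :
  (forall j, j <> i -> dot (o i) (o j) = 0) -> nrm (o i) = 1 ->
  (forall j, j <> i -> dot x (o j) = 0) ->
  P (cl_span (range o)) x = dot x (o i) *: o i.
Proof.
move=> oo o1 xo; apply: proj_cl_span.
  by apply: (subspaceZ (closed_cl_span _)); apply: sub_cl_span; exists i.
move=> _ [j _ <-]; rewrite dotBl dotZl.
have [->|ji] := pselect (j = i).
  by rewrite (dotxx norm_dot) o1 expr1n of_real1 mulr1 subrr.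
by rewrite oo // xo // mulr0 subr0.
Qed.

End Span.

(** * The spaces W, X, Y built from almost common vectors *)

Section Divergence.
Context (R : realType) (s : scalar_kind).
Context (H : completeNormedModType (scalars R s)).
Context (dot : {dot H for @scalar_conj R s}).
Hypothesis norm_dot : forall x : H, `|x| ^+ 2 = dot x x.
Local Notation F := (scalars R s).
Local Notation ofr := (@of_real R s).
Local Notation P := (orth_proj dot).
Local Notation ip := (re_dot dot).
Implicit Types (x y z : H) (a b : F) (r t : R).

Context (K : nat) (b : 'I_K -> nat * nat * bool * bool -> H).
Hypothesis b_unit : forall k (a : nat * nat * bool * bool), nrm (b k a) = 1.
Hypothesis b_orth : forall k l (a a' : nat * nat * bool * bool), a != a' -> dot (b k a) (b l a') = 0.
Hypothesis b_close : forall k l (a : nat * nat * bool * bool), nrm (b k a - b l a) <= closeness R a.1.1.1.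
Context (lw lx ly : 'I_K).
Hypotheses (wx : lw != lx) (wy : lw != ly) (xy : lx != ly).

(* The vectors x_i are indexed by (n, j, bit). The one with bit = false belongs to the
   direction q of step (n, j); the one with bit = true belongs to the orthogonal direction
   of the same plane and is never killed: it is there to make the vectors w_N orthonormal.
   The additional index j = steps n, never killed either, completes the sum of the weights.
   The vectors b k (n, j, bit, true) only serve to tilt Y. *)
Definition site n := ('I_(steps n).+1 * bool)%type.
Definition idx n (i : site n) : nat * nat * bool := (n, nat_of_ord i.1, i.2).
Definition cf n (i : site n) (al be : R) : R := weight R n i.1 * frame_coord n i.1 i.2 al be.

Definition combine k n (c : site n -> R) : H := \sum_i ofr (c i) *: b k (idx i, false).
Definition sv k n al be := combine k (fun i : site n => cf i al be).
(** The copy in [Lk k] of al w_N + be w_(N+1). The vector w_N is the second axis of stage N and the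
    first axis of stage N + 1, so three stages are involved. *)
Definition plane k N al be := sv k N 0 al + sv k N.+1 al be + sv k N.+2 be 0.
Definition wv N := plane lw N 1 0.

Lemma idx_inj n : injective (@idx n).
Proof. by move=> [i c] [j d] [] /= /val_inj -> ->. Qed.

Lemma combineD k n (c d : site n -> R) :
  combine k (fun i => c i + d i) = combine k c + combine k d.
Proof. by rewrite -big_split; apply: eq_bigr => i _; rewrite of_realD scalerDl. Qed.

Lemma combineZ k n r (c : site n -> R) : combine k (fun i => r * c i) = ofr r *: combine k c.
Proof. by rewrite scaler_sumr; apply: eq_bigr => i _; rewrite of_realM scalerA. Qed.

Lemma eq_combine k n (c d : site n -> R) : c =1 d -> combine k c = combine k d.
Proof. by move=> cd; apply: eq_bigr => i _; rewrite cd. Qed.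

Lemma svD k n al be al' be' : sv k n (al + al') (be + be') = sv k n al be + sv k n al' be'.
Proof.
by rewrite -combineD; apply: eq_combine => i; rewrite /cf frame_coordD mulrDr.
Qed.

Lemma svZ k n r al be : sv k n (r * al) (r * be) = ofr r *: sv k n al be.
Proof.
by rewrite -combineZ; apply: eq_combine => i; rewrite /cf frame_coordZ mulrCA.
Qed.

Lemma planeD k N al be al' be' :
  plane k N (al + al') (be + be') = plane k N al be + plane k N al' be'.
Proof.
rewrite /plane -[in sv k N _ _](addr0 0) -[in sv k N.+2 _ _](addr0 0) !svD.
by rewrite (addrACA (sv k N 0 al)) (addrACA (sv k N 0 al + _)).
Qed.

Lemma planeZ k N r al be : plane k N (r * al) (r * be) = ofr r *: plane k N al be.
Proof.
by rewrite /plane -[in sv k N _ _](mulr0 r) -[in sv k N.+2 _ _](mulr0 r) !svZ !scalerDr.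
Qed.

Lemma sv0 k n : sv k n 0 0 = 0.
Proof. by rewrite -[in sv k n _ _](mul0r 0) svZ of_real0 scale0r. Qed.

Lemma plane01 N : plane lw N 0 1 = wv N.+1.
Proof. by rewrite /wv /plane !sv0 add0r addr0. Qed.

Lemma plane_wv N al be : plane lw N al be = ofr al *: wv N + ofr be *: wv N.+1.
Proof.
rewrite -plane01 -!planeZ -planeD; congr (plane lw N _ _); ring.
Qed.

Lemma dot_combine k n n' (c : site n -> R) (c' : site n' -> R) :
  n != n' -> dot (combine k c) (combine k c') = 0.
Proof.
move=> nn'; rewrite dot_suml big1 // => i _; rewrite dotZl dot_sumr big1 ?mulr0 // => j _.
rewrite dotZr b_orth ?mulr0 // !xpair_eqE /= negb_and eqxx orbF.
by rewrite (negbTE nn').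
Qed.

Lemma dot_combine_same k n (c c' : site n -> R) :
  dot (combine k c) (combine k c') = ofr (\sum_i c i * c' i).
Proof.
rewrite dot_suml of_real_sum; apply: eq_bigr => i _; rewrite dotZl dot_sumr (bigD1 i) //=.
rewrite dotZr scalar_conj_real (dotxx norm_dot) b_unit expr1n of_real1 mulr1 big1.
  by rewrite addr0 of_realM.
move=> j ji; rewrite dotZr b_orth ?mulr0 //.
by apply: contra ji => /eqP/(congr1 fst) h; apply/eqP/esym/idx_inj.
Qed.

(** The frames are orthonormal and the squared weights of a stage add up to 1/2. *)
Lemma dot_sv k n al be al' be' :
  dot (sv k n al be) (sv k n al' be') = ofr (2^-1 * (al * al' + be * be')).
Proof.
rewrite dot_combine_same -(sum_weight R n) mulr_suml; congr ofr.
rewrite -(pair_bigA _ (fun j bit => cf (j, bit) al be * cf (j, bit) al' be')) /=.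
apply: eq_bigr => j _; rewrite -(frame_coord_dot n j) mulr_sumr; apply: eq_bigr => bit _.
by rewrite /cf /=; ring.
Qed.

Lemma dot_plane k N al be al' be' :
  dot (plane k N al be) (plane k N al' be') = ofr (al * al' + be * be').
Proof.
rewrite /plane !(dotDl, dotDr) !dot_sv.
have d n n' c c' : n != n' -> dot (combine k (c : site n -> R)) (combine k (c' : site n' -> R)) = 0.
  exact: dot_combine.
rewrite !d ?addr0 ?add0r; try lia.
by rewrite -!of_realD; congr ofr; field.
Qed.

Lemma wv_orth N N' : N != N' -> dot (wv N) (wv N') = 0.
Proof.
wlog NN' : N N' / (N < N')%N => [h|] neq.
  have [lt|lt|eq] := ltngtP N N'; [exact: h|by apply: dot_eq0C; apply: h; rewrite // eq_sym|].
  by rewrite eq eqxx in neq.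
have [->|N1] := eqVneq N' N.+1.
  by rewrite -plane01 /wv dot_plane mul1r mul0r addr0 of_real0.
rewrite /wv /plane !sv0 !addr0 !dotDl !dotDr.
have d n n' c c' : n != n' -> dot (combine lw (c : site n -> R)) (combine lw (c' : site n' -> R)) = 0.
  exact: dot_combine.
by rewrite !d ?addr0; try lia.
Qed.

Lemma wv_unit N : nrm (wv N) = 1.
Proof.
apply/eqP; rewrite -(@eqrXn2 _ 2) ?nrm_ge0 // -(ipxx norm_dot) /re_dot /wv dot_plane.
by rewrite of_realK mul1r mul0r addr0 expr1n.
Qed.

Lemma nrm_plane N al be : nrm (plane lw N al be) ^+ 2 = al ^+ 2 + be ^+ 2.
Proof. by rewrite -(ipxx norm_dot) /re_dot dot_plane of_realK -!expr2. Qed.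

Definition base k (e : nat * nat * bool) := b k (e, false).

Lemma base_orth k l e e' : e != e' -> dot (base k e) (base l e') = 0.
Proof. by move=> ne; rewrite b_orth // xpair_eqE (negbTE ne). Qed.

Lemma dot_base_sv k n n' (i : site n) al be :
  dot (base k (idx i)) (sv k n' al be) = if n == n' then ofr (cf i al be) else 0.
Proof.
rewrite dot_sumr; case: eqVneq => [nn'|nn'].
  subst n'; rewrite (bigD1 i) //= dotZr scalar_conj_real (dotxx norm_dot) b_unit.
  rewrite expr1n of_real1 mulr1 big1 ?addr0 // => j ji.
  rewrite dotZr base_orth ?mulr0 //.
  by apply: contra ji => /eqP h; apply/eqP/esym/idx_inj.
rewrite big1 // => j _; rewrite dotZr base_orth ?mulr0 //.
by rewrite !xpair_eqE (negbTE nn').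
Qed.

Definition tau (e : nat * nat * bool) : R := if e.2 then 0 else tilt R e.1.1 e.1.2.
(** A unit vector, turned away from b(e, false) towards the auxiliary b(e, true) by an angle of
    squared sine [tau e]. *)
Definition yv e : H :=
  ofr (Num.sqrt (1 - tau e)) *: b ly (e, false) + ofr (Num.sqrt (tau e)) *: b ly (e, true).

(** W for [lw], Y for [ly]; the letter [lx] and a possible fourth one both receive copies of X. *)
Definition spaces k : set H :=
  if k == lw then cl_span dot (range wv)
  else if k == ly then cl_span dot (range yv) else cl_span dot (range (base k)).

Lemma closed_spaces k : closed_subspace (spaces k).
Proof. by rewrite /spaces; do 2?case: ifP => _; exact: (closed_cl_span norm_dot). Qed.

Lemma tau_ge0 e : 0 <= tau e.
Proof. by rewrite /tau; case: ifP => // _; exact: tilt_ge0. Qed.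
Lemma tau_le1 e : tau e <= 1.
Proof. by rewrite /tau; case: ifP => // _; exact: tilt_le1. Qed.

Lemma yv_orth e e' : e != e' -> dot (yv e) (yv e') = 0.
Proof.
move=> ne; have d u v : dot (b ly (e, u)) (b ly (e', v)) = 0.
  by rewrite b_orth // xpair_eqE (negbTE ne).
by rewrite /yv !(dotDl, dotDr, dotZl, dotZr) !d !(mulr0, addr0).
Qed.

Lemma yv_unit e : nrm (yv e) = 1.
Proof.
apply/eqP; rewrite -(@eqrXn2 _ 2) ?nrm_ge0 // -(ipxx norm_dot) /re_dot.
rewrite /yv !(dotDl, dotDr, dotZl, dotZr) !(dotxx norm_dot) !b_unit.
rewrite (b_orth _ _ (a := (e, false)) (a' := (e, true))); last by rewrite xpair_eqE andbF.
rewrite (b_orth _ _ (a := (e, true)) (a' := (e, false))); last by rewrite xpair_eqE andbF.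
rewrite !scalar_conj_real !mulr0 addr0 add0r expr1n of_real1 !mulr1 -!of_realM -of_realD of_realK.
by rewrite -!expr2 !sqr_sqrtr ?subr_ge0 ?tau_le1 ?tau_ge0 // subrK.
Qed.

Lemma base_yv_orth e e' : e != e' -> dot (base lx e) (yv e') = 0.
Proof.
move=> ne; have d v : dot (base lx e) (b ly (e', v)) = 0.
  by rewrite b_orth // xpair_eqE (negbTE ne).
by rewrite /yv dotDr !dotZr !d !mulr0 addr0.
Qed.

Definition lam e : R := (1 - tau e) * modulus (dot (base lx e) (base ly e)) ^+ 2.

(** Unit vectors within c <= 1 of each other have inner product at least 1 - c^2 / 2 >= 1 - c /
    2. *)
Lemma lam_bounds e : [/\ 0 <= lam e, lam e <= 1 - tau e & 1 - lam e <= tau e + closeness R e.1.1].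
Proof.
have t0 := tau_ge0 e; have t1 := tau_le1 e.
set m := modulus (dot (base lx e) (base ly e)).
have m1 : m <= 1.
  by apply: le_trans (cauchy_schwarz norm_dot _ _) _; rewrite !b_unit mulr1.
have m0 : 0 <= m := modulus_ge0 _.
set c := closeness R e.1.1; have c0 : 0 < c := closeness_gt0 _ _.
have c1 : c <= 1 := closeness_le1 _ _.
have mc : 1 - c / 2 <= m.
  apply: (@le_trans _ _ (ip (base lx e) (base ly e))).
    have := nrm_sqB norm_dot (base lx e) (base ly e); rewrite !b_unit.
    have : nrm (base lx e - base ly e) ^+ 2 <= c ^+ 2.
      by rewrite ler_pXn2r ?nnegrE ?nrm_ge0 ?(ltW c0) //; exact: b_close.
    by nra.
  by apply: le_trans (ler_norm _) (re_part_le _).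
rewrite /lam -/m; split; first by rewrite mulr_ge0 ?sqr_ge0 // subr_ge0.
  by rewrite ler_piMr ?subr_ge0 // expr_le1.
have mm : 1 - c <= m ^+ 2 by nra.
nra.
Qed.

(** Only y_e is not orthogonal to x_e, so P_Y and then P_X return to the line of x_e. *)
Lemma proj_yx e : P (spaces lx) (P (spaces ly) (base lx e)) = ofr (lam e) *: base lx e.
Proof.
have yw : ly == lw = false by rewrite eq_sym (negbTE wy).
have xw : lx == lw = false by rewrite eq_sym (negbTE wx).
rewrite /spaces yw xw eqxx (negbTE xy).
have -> : P (cl_span dot (range yv)) (base lx e) = dot (base lx e) (yv e) *: yv e.
  apply: (proj_cl_span_orthonormal norm_dot); [|exact: yv_unit|];
    move=> e' /eqP ne; [apply: yv_orth|apply: base_yv_orth]; by rewrite eq_sym.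
rewrite (proj_cl_span_orthonormal norm_dot (i := e)); first last.
- by move=> e' /eqP ne; rewrite dotZl (dot_eq0C (base_yv_orth ne)) mulr0.
- exact: b_unit.
- by move=> e' /eqP ne; apply: base_orth; rewrite eq_sym.
congr (_ *: _); rewrite dotZl (dotC dot (base lx e) (yv e)) mul_conj; congr ofr.
rewrite /yv dotDr !dotZr [X in _ + _ * X]b_orth ?mulr0 ?addr0; last by rewrite xpair_eqE andbF.
rewrite modulusM scalar_conj_real modulus_real exprMn real_normK ?num_real //.
by rewrite sqr_sqrtr // subr_ge0 tau_le1.
Qed.

Local Notation proj := (foldl (fun y k => P (spaces k) y)).

Lemma proj_yx_iter n e : proj (base lx e) (flatten (nseq n [:: ly; lx])) = ofr (lam e ^+ n) *: base lx e.
Proof.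
elim: n => [|n ih] /=; first by rewrite expr0 of_real1 scale1r.
by rewrite proj_yx (projsZ norm_dot closed_spaces) ih scalerA -of_realM -exprS.
Qed.

Lemma proj_yx_combine m n (c : site n -> R) :
  proj (combine lx c) (flatten (nseq m [:: ly; lx])) = combine lx (fun i => lam (idx i) ^+ m * c i).
Proof.
rewrite (projs_sum norm_dot closed_spaces); apply: eq_bigr => i _.
by rewrite (projsZ norm_dot closed_spaces) proj_yx_iter scalerA -of_realM mulrC.
Qed.

Lemma base_in k e : k != lw -> k != ly -> spaces k (base k e).
Proof.
by move=> /negbTE kw /negbTE ky; rewrite /spaces kw ky; apply: sub_cl_span; exists e.
Qed.

Lemma wv_in N : spaces lw (wv N).
Proof. by rewrite /spaces eqxx; apply: sub_cl_span; exists N. Qed.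

Lemma plane_in N al be : spaces lw (plane lw N al be).
Proof.
rewrite plane_wv; apply: (subspaceD (closed_spaces lw));
  apply: (subspaceZ (closed_spaces lw)); exact: wv_in.
Qed.

(** Only w_N and w_(N+1) involve stage N + 1. For [bit] = false the result is the weight times the
    unit vector q. *)
Lemma proj_w_base N (i : site N.+1) :
  P (spaces lw) (base lw (idx i)) = plane lw N (cf i 1 0) (cf i 0 1).
Proof.
have E : spaces lw = cl_span dot (range wv) by rewrite /spaces eqxx.
rewrite E; apply: (proj_cl_span norm_dot); first by rewrite -E; exact: plane_in.
move=> _ [N' _ <-]; rewrite dotBl plane_wv.
have -> : dot (base lw (idx i)) (wv N') =
    ofr (if N == N' then cf i 1 0 else if N.+1 == N' then cf i 0 1 else 0).
  rewrite /wv /plane sv0 addr0 dotDr !dot_base_sv eqSS.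
  have [<-|] := eqVneq N N'; first by rewrite gtn_eqF // add0r.
  by rewrite addr0; case: ifP; rewrite ?of_real0.
rewrite [dot (_ + _) _]dotDl !dotZl.
have [<-|n0] := eqVneq N N'.
  by rewrite (dotxx norm_dot) wv_unit (@wv_orth N.+1 N) ?gtn_eqF // mulr0 addr0 expr1n of_real1 mulr1 subrr.
have [<-|n1] := eqVneq N.+1 N'.
  by rewrite (dotxx norm_dot) wv_unit (@wv_orth N N.+1) ?ltn_eqF // mulr0 add0r expr1n of_real1 mulr1 subrr.
by rewrite !wv_orth // !mulr0 addr0 of_real0 subrr.
Qed.

Lemma combine_le k n (c : site n -> R) (e : R) : (forall i, `|c i| <= e) ->
  nrm (combine k c) <= #|{: site n}|%:R * e.
Proof.
move=> ce; apply: le_trans (nrm_sum _ _ _) _.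
apply: (@le_trans _ _ (\sum_(i : site n) e)).
  by apply: ler_sum => i _; rewrite nrmZr b_unit mulr1.
by rewrite sumr_const -[leLHS]mulr_natl.
Qed.

Lemma combineB k n (c d : site n -> R) :
  combine k c - combine k d = combine k (fun i => c i - d i).
Proof.
rewrite -[combine k d]scale1r -scaleNr -(of_real1 R s) -of_realN -combineZ -combineD.
by apply: eq_combine => i; rewrite mulN1r.
Qed.

Lemma combine_close k l n (c : site n -> R) : (forall i, `|c i| <= 1) ->
  nrm (combine k c - combine l c) <= #|{: site n}|%:R * closeness R n.
Proof.
move=> c1; rewrite -sumrB; apply: le_trans (nrm_sum _ _ _) _.
apply: (@le_trans _ _ (\sum_(i : site n) closeness R n)).
  apply: ler_sum => i _; rewrite -scalerBr nrmZr.
  by apply: le_trans (b_close k l (idx i, false)); rewrite ler_piMl ?nrm_ge0.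
by rewrite sumr_const -[leLHS]mulr_natl.
Qed.

Lemma cf_le n (i : site n) al be : al ^+ 2 + be ^+ 2 <= 1 -> `|cf i al be| <= weight R n i.1.
Proof.
move=> h; rewrite normrM ger0_norm ?weight_ge0 //.
by rewrite ler_piMr ?weight_ge0 // frame_coord_le.
Qed.

Lemma cf_le1 n (i : site n) al be : al ^+ 2 + be ^+ 2 <= 1 -> `|cf i al be| <= 1.
Proof. by move=> h; apply: le_trans (cf_le i h) (weight_le1 _ _ _). Qed.

(** * One small step of the rotation *)

Section Round.
Variables (N j p : nat) (eta : R).
Hypothesis jN : (j < steps N.+1)%N.
Hypothesis eta0 : 0 < eta.
Hypothesis close_eta : forall n, (N <= n <= N.+2)%N ->
  closeness R n <= eta /\ p%:R * closeness R n <= eta.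
Hypothesis other_eta : forall n i, (N <= n <= N.+2)%N -> (n, i) != (N.+1, j) ->
  2 * weight R n i <= eta \/ p%:R * (tilt R n i + closeness R n) <= eta.
Hypothesis kill_eta : (1 - tilt R N.+1 j) ^+ p <= eta.

Definition killed : site N.+1 := (Ordinal (ltnW jN : (j < (steps N.+1).+1)%N), false).
(** Applied to a vector of W, this word is W (X Y X)^p W. *)
Definition mini := lx :: flatten (nseq p [:: ly; lx]) ++ [:: lw].
Definition others := [seq k <- enum 'I_K | k \notin [:: lw; lx; ly]].
Definition budget : R :=
  (#|{: site N}|%:R + #|{: site N.+1}|%:R + #|{: site N.+2}|%:R) * eta.

Lemma plane_close k l al be : al ^+ 2 + be ^+ 2 <= 1 ->
  nrm (plane k N al be - plane l N al be) <= budget.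
Proof.
move=> h; have ha : 0 ^+ 2 + al ^+ 2 <= 1 by have := sqr_ge0 be; lra.
have hb : be ^+ 2 + 0 ^+ 2 <= 1 by have := sqr_ge0 al; lra.
have st n al' be' : (N <= n <= N.+2)%N -> al' ^+ 2 + be' ^+ 2 <= 1 ->
    nrm (sv k n al' be' - sv l n al' be') <= #|{: site n}|%:R * eta.
  move=> hn h'; apply: le_trans (combine_close _ _ (fun i => cf_le1 i h')) _.
  by rewrite ler_wpM2l //; case: (close_eta hn).
rewrite /plane /budget !opprD addrACA (addrACA (sv k N 0 al)) !mulrDl.
apply: le_trans (nrmD _ _) (lerD (le_trans (nrmD _ _) (lerD _ _)) _); apply: st => //; lia.
Qed.

Definition remove n (c : site n -> R) (i : site n) : R :=
  if idx i == idx killed then 0 else c i.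

(** The power [p] acts almost like deleting the killed coordinate. Its own eigenvalue power is below
    eta; elsewhere the weight is negligible, or the tilt is so small that the power stays near 1. *)
Lemma diag_close n (c : site n -> R) : (N <= n <= N.+2)%N ->
  (forall i, `|c i| <= weight R n i.1) ->
  nrm (combine lx (fun i => lam (idx i) ^+ p * c i) - combine lx (remove c)) <= #|{: site n}|%:R * eta.
Proof.
move=> hn hc; rewrite combineB; apply: combine_le => i.
have [l0 l1 l2] := lam_bounds (idx i).
have lt1 : lam (idx i) <= 1 by apply: le_trans l1 _; rewrite gerBl tau_ge0.
have L1 : lam (idx i) ^+ p <= 1 by rewrite exprn_ile1.
have L0 : 0 <= lam (idx i) ^+ p by rewrite exprn_ge0.
have c1 : `|c i| <= 1 := le_trans (hc i) (weight_le1 _ _ _).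
rewrite /remove; case: eqP => [ki|ki].
  rewrite subr0 normrM ger0_norm //.
  apply: (@le_trans _ _ (lam (idx i) ^+ p)); first by rewrite ler_piMr.
  apply: le_trans kill_eta; rewrite lerXn2r ?nnegrE ?subr_ge0 ?tilt_le1 //.
  by move: l1; rewrite ki.
have -> : lam (idx i) ^+ p * c i - c i = - ((1 - lam (idx i) ^+ p) * c i) by ring.
rewrite normrN normrM ger0_norm ?subr_ge0 //.
(* Bernoulli's inequality. *)
have bern : 1 - lam (idx i) ^+ p <= p%:R * (1 - lam (idx i)).
  elim: (p) => [|q ih]; first by rewrite expr0 subrr mul0r.
  rewrite exprS -natr1; set L := lam _ ^+ q in ih *.
  have : L <= 1 by rewrite exprn_ile1.
  have : 0 <= L by rewrite exprn_ge0.
  nra.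
have small : p%:R * (tau (idx i) + closeness R n) <= eta -> (1 - lam (idx i) ^+ p) * `|c i| <= eta.
  move=> h; apply: (@le_trans _ _ (1 - lam (idx i) ^+ p)); first by rewrite ler_piMr ?subr_ge0.
  by apply: le_trans bern (le_trans _ h); rewrite ler_wpM2l.
have [bit|bit] := boolP i.2.
  by apply: small; rewrite /tau /= bit add0r; case: (close_eta hn).
have nk : (n, nat_of_ord i.1) != (N.+1, j).
  apply/eqP => -[en ei]; apply: ki; congr (_, _, _) => //.
  exact: negbTE.
have [h|h] := other_eta hn nk; last by apply: small; rewrite /tau /= (negbTE bit).
apply: le_trans h; apply: (@le_trans _ _ `|c i|).
  by rewrite ler_piMl // gerBl.
by apply: le_trans (hc i) _; rewrite ler_peMl ?weight_ge0 // ler1n.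
Qed.

Lemma remove_close n (c : site n -> R) : (N <= n <= N.+2)%N ->
  (forall i, `|c i| <= 1) ->
  nrm (combine lx (remove c) - combine lw (remove c)) <= #|{: site n}|%:R * eta.
Proof.
move=> hn hc; apply: le_trans (combine_close _ _ _) _.
  by move=> i; rewrite /remove; case: ifP => _ //; rewrite normr0.
by rewrite ler_wpM2l //; case: (close_eta hn).
Qed.

Lemma remove_other k n (c : site n -> R) : n != N.+1 -> combine k (remove c) = combine k c.
Proof.
move=> nN; apply: eq_combine => i; rewrite /remove; case: eqP => // -[en].
by rewrite en eqxx in nN.
Qed.

Lemma remove_killed k (c : site N.+1 -> R) :
  combine k (remove c) = combine k c - ofr (c killed) *: base k (idx killed).
Proof.
rewrite /combine (bigD1 killed) //= [in RHS](bigD1 killed) //= addrAC subrr add0r.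
rewrite /remove eqxx of_real0 scale0r add0r; apply: eq_bigr => i ik.
by case: eqP => // /idx_inj e; rewrite e eqxx in ik.
Qed.

(** Up to errors, v becomes v - d <v,q> q with d the squared weight. One [budget] is spent on each
    further letter, on passing from W to X, on the diagonal power, and on passing back. *)
Lemma mini_round al be : al ^+ 2 + be ^+ 2 <= 1 ->
  nrm (proj (plane lw N al be) (others ++ mini) -
       (plane lw N al be - ofr (cf killed al be) *: plane lw N (cf killed 1 0) (cf killed 0 1)))
    <= ((size others)%:R + 3) * budget.
Proof.
move=> h; have ha : 0 ^+ 2 + al ^+ 2 <= 1 by have := sqr_ge0 be; lra.
have hb : be ^+ 2 + 0 ^+ 2 <= 1 by have := sqr_ge0 al; lra.
have cS := closed_spaces.
pose v k := plane k N al be; rewrite -/(v lw).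
have [nN nN1 nN2] : [/\ N <= N <= N.+2, N <= N.+1 <= N.+2 & N <= N.+2 <= N.+2]%N.
  by split; lia.
have v_in k : k != lw -> k != ly -> spaces k (v k).
  move=> kw ky; have sin n al' be' : spaces k (sv k n al' be').
    apply: (subspace_sum (cS k)) => i _; apply: (subspaceZ (cS k)); exact: base_in.
  by apply: (subspaceD (cS k)) => //; apply: (subspaceD (cS k)).
pose u := proj (v lw) others.
have hu : nrm (v lw - u) <= (size others)%:R * budget.
  apply: (almost_fixed_projs norm_dot cS) => k.
  rewrite mem_filter !inE !negb_or => /andP[/and3P[kw kx ky] _].
  apply: le_trans (defect_le norm_dot cS _ (v_in k kw ky)) _.
  exact: plane_close.
pose d := combine lx (fun i : site N => lam (idx i) ^+ p * cf i 0 al) +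
  combine lx (fun i : site N.+1 => lam (idx i) ^+ p * cf i al be) +
  combine lx (fun i : site N.+2 => lam (idx i) ^+ p * cf i be 0).
have xw : lx != lw by rewrite eq_sym.
have hd : nrm (proj u (lx :: flatten (nseq p [:: ly; lx])) - d) <= nrm (u - v lx).
  have -> : d = proj (v lx) (lx :: flatten (nseq p [:: ly; lx])).
    rewrite /= (orth_proj_id norm_dot (cS lx) (v_in lx xw xy)).
    by rewrite !(projsD norm_dot cS) !proj_yx_combine.
  exact: (projs_nonexp norm_dot cS).
pose t k := combine k (remove (fun i : site N => cf i 0 al)) +
  combine k (remove (fun i : site N.+1 => cf i al be)) +
  combine k (remove (fun i : site N.+2 => cf i be 0)).
have three (a1 a2 a3 b1 b2 b3 : H) : nrm (a1 - b1) <= #|{: site N}|%:R * eta ->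
    nrm (a2 - b2) <= #|{: site N.+1}|%:R * eta -> nrm (a3 - b3) <= #|{: site N.+2}|%:R * eta ->
    nrm (a1 + a2 + a3 - (b1 + b2 + b3)) <= budget.
  move=> h1 h2 h3; rewrite !opprD addrACA (addrACA a1) /budget !mulrDl.
  by apply: le_trans (nrmD _ _) (lerD (le_trans (nrmD _ _) (lerD _ _)) _).
have hdt : nrm (d - t lx) <= budget.
  by apply: three; apply: diag_close => // i; exact: cf_le.
have htt : nrm (t lx - t lw) <= budget.
  by apply: three; apply: remove_close => // i; exact: cf_le1.
have tw : P (spaces lw) (t lw) =
    v lw - ofr (cf killed al be) *: plane lw N (cf killed 1 0) (cf killed 0 1).
  have -> : t lw = v lw - ofr (cf killed al be) *: base lw (idx killed).
    rewrite /t remove_killed (@remove_other _ N) ?ltn_eqF // (@remove_other _ N.+2) ?gtn_eqF //.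
    by rewrite addrA [LHS]addrAC.
  rewrite (orth_projB norm_dot (cS lw)) (orth_projZ norm_dot (cS lw)) proj_w_base.
  by rewrite (orth_proj_id norm_dot (cS lw)) //; exact: plane_in.
rewrite -tw foldl_cat -/u /mini -cat_cons foldl_cat /= -[proj _ _]/(proj u (lx :: _)).
set e := proj u _ in hd *.
apply: le_trans (proj_nonexp norm_dot (cS lw) _ _) _.
have h1 := nrm_tri d e (t lw); have h2 := nrm_tri (t lx) d (t lw).
have h3 := nrm_tri (v lw) u (v lx).
have h4 : nrm (v lw - v lx) <= budget by exact: plane_close.
rewrite (nrmB u (v lw)) in h3; lra.
Qed.

(** Component A along the target position j + 1 and B along q. *)
Definition polar A B : H := plane lw N (A * posC R N.+1 j.+1 - B * posS R N.+1 j.+1)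
  (A * posS R N.+1 j.+1 + B * posC R N.+1 j.+1).

Lemma round_iter A B q : A ^+ 2 + B ^+ 2 <= 1 ->
  nrm (proj (polar A B) (flatten (nseq q (others ++ mini))) -
       polar A ((1 - weight R N.+1 j ^+ 2) ^+ q * B)) <= q%:R * (((size others)%:R + 3) * budget).
Proof.
set C := posC R N.+1 j.+1; set S := posS R N.+1 j.+1; pose U B' := polar A B'.
set D := 1 - weight R N.+1 j ^+ 2.
rewrite -/(U _) -/(U _); have cs1 : C ^+ 2 + S ^+ 2 = 1 := pos_unit _ _ _.
have D0 : 0 <= D by rewrite subr_ge0 expr_le1 ?weight_ge0 ?weight_le1.
have D1 : D <= 1 by rewrite gerBl sqr_ge0.
elim: q B => [|q ih] B AB; rewrite -?/(U _); first by rewrite expr0 mul1r subrr nrm0 mul0r.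
rewrite [flatten _]/= foldl_cat.
have -> t : q.+1%:R * t = t + q%:R * t :> R by rewrite -natr1 mulrDl mul1r addrC.
have AB' : A ^+ 2 + (D * B) ^+ 2 <= 1.
  apply: le_trans AB; rewrite lerD2l exprMn ler_piMl ?sqr_ge0 // expr_le1 //.
have mr : nrm (proj (U B) (others ++ mini) - U (D * B)) <= ((size others)%:R + 3) * budget.
  have h : (A * C - B * S) ^+ 2 + (A * S + B * C) ^+ 2 <= 1.
    have -> : (A * C - B * S) ^+ 2 + (A * S + B * C) ^+ 2 =
      (A ^+ 2 + B ^+ 2) * (C ^+ 2 + S ^+ 2) by ring.
    by rewrite cs1 mulr1.
  have := mini_round h.
  have -> : U (D * B) = plane lw N (A * C - B * S) (A * S + B * C) -
      ofr (cf killed (A * C - B * S) (A * S + B * C)) *: plane lw N (cf killed 1 0) (cf killed 0 1).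
    rewrite -[- (ofr _ *: _)]scaleNr -of_realN -planeZ -planeD /U /polar; congr (plane lw N _ _);
    rewrite /cf /= /frame_coord -/C -/S /D.
      have -> : weight R N.+1 j * (C * (A * S + B * C) - S * (A * C - B * S)) =
        weight R N.+1 j * B * (C ^+ 2 + S ^+ 2) by ring.
      by rewrite cs1; ring.
    have -> : weight R N.+1 j * (C * (A * S + B * C) - S * (A * C - B * S)) =
      weight R N.+1 j * B * (C ^+ 2 + S ^+ 2) by ring.
    by rewrite cs1; ring.
  by [].
rewrite exprSr -mulrA.
apply: le_trans (nrm_tri (proj (U (D * B)) (flatten (nseq q (others ++ mini)))) _ _) _.
apply: lerD (ih _ AB').
exact: le_trans (projs_nonexp norm_dot closed_spaces _ _ _) mr.
Qed.

(** The position j has components A and B, the cosine and (up to sign) the sine of a small angle, in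
    the frame of position j + 1. The rounds shrink B, and 1 - A is bounded by [pos_close]. *)
Lemma round_close q :
  nrm (proj (plane lw N (posC R N.+1 j) (posS R N.+1 j)) (flatten (nseq q (others ++ mini))) -
       plane lw N (posC R N.+1 j.+1) (posS R N.+1 j.+1)) <=
  q%:R * (((size others)%:R + 3) * budget) + (1 - weight R N.+1 j ^+ 2) ^+ q
    + 4 / (steps N.+1)%:R ^+ 2.
Proof.
set C := posC R N.+1 j.+1; set S := posS R N.+1 j.+1.
set C0 := posC R N.+1 j; set S0 := posS R N.+1 j.
have cs1 : C ^+ 2 + S ^+ 2 = 1 := pos_unit _ _ _.
have cs0 : C0 ^+ 2 + S0 ^+ 2 = 1 := pos_unit _ _ _.
set D := 1 - weight R N.+1 j ^+ 2.
have D0 : 0 <= D by rewrite subr_ge0 expr_le1 ?weight_ge0 ?weight_le1.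
pose A := C0 * C + S0 * S; pose B := C * S0 - S * C0.
have AB : A ^+ 2 + B ^+ 2 = 1.
  have -> : A ^+ 2 + B ^+ 2 = (C0 ^+ 2 + S0 ^+ 2) * (C ^+ 2 + S ^+ 2) by rewrite /A /B; ring.
  by rewrite cs0 cs1 mulr1.
have A1 : A <= 1 by have := sqr_ge0 B; nra.
have hA : 1 - A <= 4 / (steps N.+1)%:R ^+ 2 by exact: pos_close.
have B1 : `|B| <= 1.
  by rewrite -(@ler_pXn2r _ 2) ?nnegrE // real_normK ?num_real // expr1n -AB lerDr sqr_ge0.
have AB1 : A ^+ 2 + B ^+ 2 <= 1 by rewrite AB.
have := @round_iter A B q AB1; rewrite /polar -/C -/S -/D.
have -> : plane lw N (A * C - B * S) (A * S + B * C) = plane lw N C0 S0.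
  congr (plane lw N _ _).
    have -> : A * C - B * S = C0 * (C ^+ 2 + S ^+ 2) by rewrite /A /B; ring.
    by rewrite cs1 mulr1.
  have -> : A * S + B * C = S0 * (C ^+ 2 + S ^+ 2) by rewrite /A /B; ring.
  by rewrite cs1 mulr1.
set B' := D ^+ q * B => h.
apply: le_trans (nrm_tri (plane lw N (A * C - B' * S) (A * S + B' * C)) _ _) _.
rewrite -[leRHS]addrA; apply: lerD h _.
have -> : plane lw N (A * C - B' * S) (A * S + B' * C) - plane lw N C S =
    plane lw N (- (1 - A) * C - B' * S) (- (1 - A) * S + B' * C).
  rewrite -[plane lw N C S]scale1r -[- (1 *: plane lw N C S)]scaleNr -(of_real1 R s) -of_realN -planeZ -planeD.
  by congr (plane lw N _ _); ring.
apply: (@le_trans _ _ (`|B'| + (1 - A))); last first.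
  rewrite lerD // /B' normrM ger0_norm ?exprn_ge0 //.
  by rewrite ler_piMr ?exprn_ge0.
apply: nrm_le_sq; first by rewrite addr_ge0 // subr_ge0.
rewrite nrm_plane.
have -> : (- (1 - A) * C - B' * S) ^+ 2 + (- (1 - A) * S + B' * C) ^+ 2 =
   ((1 - A) ^+ 2 + B' ^+ 2) * (C ^+ 2 + S ^+ 2) by ring.
rewrite cs1 mulr1 [leRHS]sqrrD real_normK ?num_real //.
have : 0 <= `|B'| * (1 - A) by rewrite mulr_ge0 // subr_ge0.
by lra.
Qed.

Lemma mem_round q : (0 < p)%N -> (0 < q)%N ->
  forall k, k \in flatten (nseq q (others ++ mini)).
Proof.
rewrite /mini; case: p => // p' _; case: q => // q _ k.
rewrite /= mem_cat mem_cat; have [kin|knot] := boolP (k \in [:: lw; lx; ly]); last first.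
  by rewrite mem_filter knot mem_enum.
by move: kin; rewrite !(inE, mem_cat) => /or3P[] ->; rewrite ?orbT.
Qed.

End Round.

(** * From single steps to a divergent sequence *)

Hypothesis few : (size others <= 1)%N.

Lemma step_word N j : (j < steps N.+1)%N -> exists r : seq 'I_K,
  (forall k, k \in r) /\
  nrm (proj (plane lw N (posC R N.+1 j) (posS R N.+1 j)) r -
       plane lw N (posC R N.+1 j.+1) (posS R N.+1 j.+1)) <= 2^-1 ^+ (2 * N + 11).
Proof.
move=> jN; have [m [p [eta [[e0 hm hb] hc ho hk]]]] := parameters R jN.
have half1 n : 2^-1 ^+ n.+1 < 1 :> R.
  by rewrite exprn_ilt1 // ?invr_ge0 // invf_lt1 // ltr1n.
have m0 : (0 < m)%N.
  rewrite lt0n; apply: contraTneq hm => ->.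
  by rewrite expr0 -ltNge addnS half1.
have eta1 : eta < 1.
  apply: le_lt_trans (half1 (2 * N + 12)%N); rewrite -addnS.
  by apply: le_trans hb; rewrite ler_peMl ?(ltW e0) // -natrM ler1n muln_gt0 m0 expn_gt0.
have p0 : (0 < p)%N.
  by rewrite lt0n; apply: contraTneq hk => ->; rewrite expr0 -ltNge.
exists (flatten (nseq m (others ++ mini p))); split; first exact: mem_round.
apply: le_trans (round_close jN e0 hc ho hk m) _.
(* The error 2^-(2N+11) is shared: half for the cosine, a quarter each for the accumulated budgets
   and the remaining component along q. *)
have k2 : 4 / (steps N.+1)%:R ^+ 2 <= 2^-1 ^+ (2 * N + 12) :> R.
  rewrite /steps -natrX -expnM -[leLHS]mul1r mulrA mul1r ler_pdivrMr ?ltr0n ?expn_gt0 //.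
  have -> : (((N.+1 + 6) * 2) = (2 * N + 12) + 2)%N by lia.
  rewrite expnD natrM mulrA natrX -exprMn mulVf // expr1n mul1r //.
have bud : m%:R * (((size others)%:R + 3) * budget N eta) <= 2^-1 ^+ (2 * N + 13) :> R.
  apply: le_trans hb; rewrite -mulrA ler_wpM2l // /budget !card_prod card_bool !card_ord.
  rewrite mulrA ler_wpM2r ?(ltW e0) // -!natrD -natrM ler_nat.
  apply: (@leq_trans (4 * 2 ^ (N + 11))); last first.
    by rewrite -(expnD 2 2) leq_exp2l // ; lia.
  apply: leq_mul; first by rewrite -[4%N]/(1 + 3)%N leq_add2r.
  have h1 := leq_steps (leqnSn N); have h2 := leq_steps (leqnSn N.+1).
  have e2 : (steps N.+2 = 4 * 2 ^ (N + 6))%N by rewrite /steps !addSn !expnS; lia.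
  have e3 : (2 ^ (N + 11) = 32 * 2 ^ (N + 6))%N.
    by rewrite -(expnD 2 5); congr (2 ^ _)%N; lia.
  have : (64 <= 2 ^ (N + 6))%N by rewrite -[64%N]/(2 ^ 6)%N leq_exp2l //; lia.
  by rewrite e3; lia.
have e1 : 2^-1 ^+ (2 * N + 11) = 2 * 2^-1 ^+ (2 * N + 12) :> R.
  by rewrite [(_ + 12)%N]addnS exprS mulrA mulfV // mul1r.
have e2 : 2^-1 ^+ (2 * N + 12) = 2 * 2^-1 ^+ (2 * N + 13) :> R.
  by rewrite [(_ + 13)%N]addnS exprS mulrA mulfV // mul1r.
by rewrite e1; lra.
Qed.

(** The quarter circle takes 2^(N+7) steps with error 2^-(2N+11) each. *)
Lemma stage_word N : exists r : seq 'I_K,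
  (forall k, k \in r) /\ nrm (proj (wv N) r - wv N.+1) <= 2^-1 ^+ (N + 4).
Proof.
have [J0 S0] := pos0 R N.+1; have [J1 S1] := pos_last R N.+1.
have partial J : (J < steps N.+1)%N -> exists r : seq 'I_K, (forall k, k \in r) /\
    nrm (proj (wv N) r - plane lw N (posC R N.+1 J.+1) (posS R N.+1 J.+1)) <=
      J.+1%:R * 2^-1 ^+ (2 * N + 11).
  elim: J => [|J ih] jN.
    have [r [hr h]] := step_word jN; exists r; split=> //.
    by rewrite mul1r; move: h; rewrite J0 S0.
  have [r [hr h]] := ih (ltnW jN); have [r' [_ h']] := step_word jN.
  exists (r ++ r'); split=> [k|]; first by rewrite mem_cat hr.
  rewrite foldl_cat -natr1 mulrDl mul1r.
  apply: le_trans (nrm_tri (proj (plane lw N (posC R N.+1 J.+1) (posS R N.+1 J.+1)) r') _ _) _.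
  by apply: lerD h'; apply: le_trans (projs_nonexp norm_dot closed_spaces _ _ _) h.
have sp : (steps N.+1).-1.+1 = steps N.+1 by rewrite prednK // steps_gt0.
have [|r [hr h]] := partial (steps N.+1).-1; first by rewrite sp.
exists r; split=> //; move: h; rewrite sp J1 S1 plane01 => h; apply: le_trans h _.
by apply: ler_pow2_half; lia.
Qed.

(** The errors 2^-(N+4) add up to at most 1/8, so the iterates pass within 1/8 of every w_N; as the
    w_N are orthonormal, there is no convergence. *)
Lemma divergent_iterates : exists z0 (k : nat -> 'I_K),
  (forall j N, exists2 n, (N <= n)%N & k n = j) /\
  ~ cvgn (proj_iterates dot spaces k z0).
Proof.
have /choice [u hu] := stage_word.
have [n|k [hk hinf]] := @concat_words _ lw u.
  by have [h _] := hu n; case: (u n) h => // /(_ lw); rewrite in_nil.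
exists (wv 0), k; split.
  by move=> j N; apply: hinf => n; have [h _] := hu n; exact: h.
pose v N := flatten [seq u i | i <- iota 0 N].
have vS N : v N.+1 = v N ++ u N.
  by rewrite /v -addn1 iotaD map_cat flatten_cat /= cats0.
have szv N : (N <= size (v N))%N.
  elim: N => // N ih; rewrite vS size_cat -addn1 leq_add // lt0n size_eq0.
  by have [h _] := hu N; case: (u N) h => // /(_ lw); rewrite in_nil.
have hv N : nrm (proj (wv 0) (v N) - wv N) <= (1 - 2^-1 ^+ N) / 8.
  elim: N => [|N ih]; first by rewrite /= subrr nrm0 expr0 subrr mul0r.
  rewrite vS foldl_cat; have [_ h] := hu N.
  apply: le_trans (nrm_tri (proj (wv N) (u N)) _ _) _.
  have := projs_nonexp norm_dot closed_spaces (u N) (proj (wv 0) (v N)) (wv N).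
  move: h; rewrite exprD [2^-1 ^+ N.+1]exprS.
  have -> : 2^-1 ^+ 4 = 16^-1 :> R by rewrite exprVn -natrX.
  lra.
have zv N : proj_iterates dot spaces k (wv 0) (size (v N)) = proj (wv 0) (v N).
  by rewrite -[size _]add0n proj_iteratesD hk.
move=> /cvgn_cauchy_nrm /(_ 2^-1) [|N hN]; first by rewrite invr_gt0.
have := hN _ _ (szv N) (leq_trans (leqnSn N) (szv N.+1)); rewrite !zv.
have h1 := hv N; have h2 := hv N.+1.
have p1 : 0 <= 2^-1 ^+ N :> R by rewrite exprn_ge0 // invr_ge0.
have p2 : 0 <= 2^-1 ^+ N.+1 :> R by rewrite exprn_ge0 // invr_ge0.
have far : 1 <= nrm (wv N - wv N.+1).
  rewrite -(@ler_pXn2r _ 2) ?nnegrE ?nrm_ge0 // expr1n (nrm_sqB norm_dot) !wv_unit.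
  by rewrite (dot_ip0 (wv_orth (_ : N != N.+1))) ?ltn_eqF // mulr0 subr0 expr1n lerDl.
have h3 := nrm_tri (proj (wv 0) (v N)) (wv N) (wv N.+1).
have h4 := nrm_tri (proj (wv 0) (v N.+1)) (proj (wv 0) (v N)) (wv N.+1).
rewrite (nrmB (wv N) (proj _ _)) in h3; lra.
Qed.

Lemma spaces_sub (X : 'I_K -> set H) : (forall k, closed_subspace (X k)) ->
  (forall k (a : nat * nat * bool * bool), X k (b k a)) -> forall k, spaces k `<=` X k.
Proof.
move=> cX bX k.
have cmb (n : nat) al be : X k (sv k n al be).
  by apply: (subspace_sum (cX k)) => i _; apply: (subspaceZ (cX k)); exact: bX.
rewrite /spaces; case: eqP => [kw|_]; last case: eqP => [ky|_].
- apply: (cl_span_sub norm_dot (cX k)) => _ [N _ <-]; rewrite /wv /plane -kw.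
  by do 2?[apply: (subspaceD (cX k)) => //].
- apply: (cl_span_sub norm_dot (cX k)) => _ [e _ <-]; rewrite /yv -ky.
  by apply: (subspaceD (cX k)); apply: (subspaceZ (cX k)); exact: bX.
- by apply: (cl_span_sub norm_dot (cX k)) => _ [e _ <-]; exact: bX.
Qed.

End Divergence.

(** * The equivalence for three or four subspaces *)

Section Equivalence.
Context (R : realType) (s : scalar_kind).
Context (H : completeNormedModType (scalars R s)).
Context (dot : {dot H for @scalar_conj R s}).
Hypothesis norm_dot : forall x : H, `|x| ^+ 2 = dot x x.
Local Notation F := (scalars R s).
Local Notation orthocomp := (orthocomp dot).
Implicit Types (x y z : H) (a b : F) (r t : R).

Context (K : nat) (Lk : 'I_K -> set H).
Hypothesis cL : forall k, closed_subspace (Lk k).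
Local Notation L := (\bigcap_k Lk k).
Local Notation M := (orthocomp L).
Local Notation regular := (regular dot Lk).

Lemma not_regular_divergence : K = 3%N \/ K = 4%N -> ~ regular M ->
  exists (Lt : 'I_K -> set H) (z0 : H) (k : nat -> 'I_K),
    [/\ forall j, closed_subspace (Lt j), forall j, Lt j `<=` Lk j `&` M,
        forall j N, exists2 n, (N <= n)%N & k n = j
      & ~ cvgn (proj_iterates dot Lt k z0)].
Proof.
move=> hK nM.
(* The almost common sequence is reindexed by the countable type of quadruples; 1 is the tolerance
   at numbers that code no quadruple. *)
pose eps n : R := if unpickle n is Some e then closeness R (e : nat * nat * bool * bool).1.1.1 else 1.
have eps0 n : 0 < eps n by rewrite /eps; case: unpickle => // e; exact: closeness_gt0.
have [b [bL b1 borth bclose]] := almost_common_sequence norm_dot cL nM eps0.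
pose b' k (e : nat * nat * bool * bool) := b k (pickle e).
have b'_orth k l e e' : e != e' -> dot (b' k e) (b' l e') = 0.
  move=> ne; apply: borth; apply: contra ne => /eqP h.
  by apply/eqP; exact: (pcan_inj (@pickleK _)).
have b'_close k l e : nrm (b' k e - b' l e) <= closeness R e.1.1.1.
  by have := bclose k l (pickle e); rewrite /eps pickleK.
have K3 : (2 < K)%N by case: hK => ->.
pose lw : 'I_K := Ordinal (ltnW (ltnW K3)).
pose lx : 'I_K := Ordinal (ltnW K3).
pose ly : 'I_K := Ordinal K3.
have few : (size (others lw lx ly) <= 1)%N.
  rewrite -(leq_add2r 3) (_ : (1 + 3)%N = 4%N) // /others size_filter.
  have := count_predC (mem [:: lw; lx; ly]) (enum 'I_K); rewrite size_enum_ord.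
  have -> : count (mem [:: lw; lx; ly]) (enum 'I_K) = 3%N.
    rewrite -size_filter; have /perm_size -> // : perm_eq [seq k <- enum 'I_K | k \in [:: lw; lx; ly]] [:: lw; lx; ly].
    apply: uniq_perm => // [|i]; first by rewrite filter_uniq // enum_uniq.
    by rewrite mem_filter mem_enum andbT.
  have -> : count (predC (mem [:: lw; lx; ly])) (enum 'I_K) =
    count (fun k => k \notin [:: lw; lx; ly]) (enum 'I_K) by [].
  by move=> h; rewrite addnC h; case: hK => ->.
have [z0 [k [kinf kdiv]]] := divergent_iterates norm_dot (fun k e => b1 k (pickle e))
  b'_orth b'_close (isT : lw != lx) (isT : lw != ly) (isT : lx != ly) few.
exists (spaces dot b' lw ly), z0, k; split => //.
  by move=> j; exact: closed_spaces.
apply: (spaces_sub norm_dot) => [j|j e].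
  exact: closed_subspaceI (cL j) (closed_subspace_M norm_dot Lk).
by have [h1 h2] := bL j (pickle e).
Qed.

Lemma four_letters : K = 3%N \/ K = 4%N -> forall i j : 'I_K, i != j ->
  exists c d, forall k, k \in [:: i; j; c; d].
Proof.
move=> hK i j ij.
have c2 : (#|~: [set i; j]| <= 2)%N.
  have := cardsC [set i; j]; rewrite cards2 ij card_ord => h.
  have K4 : (K <= 4)%N by case: hK => ->.
  by rewrite -(leq_add2l 2); exact: leq_trans (eq_leq h) K4.
pose l := enum (~: [set i; j]).
have sl : (size l <= 2)%N by rewrite -cardE.
(* At most two letters remain; the default i fills the missing places. *)
exists (nth i l 0), (nth i l 1) => k.
have [kij|] := boolP (k \in [set i; j]%SET).
  by case/set2P: kij => ->; rewrite !inE eqxx ?orbT.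
rewrite -finset.in_setC -mem_enum -/l => /(nthP i) [[|[|m]] hm <-]; rewrite ?inE ?eqxx ?orbT //.
by have := leq_trans hm sl.
Qed.

End Equivalence.

Theorem theorem3p6 (R : realType) (s : scalar_kind)
    (H : completeNormedModType (scalars R s))
    (dot : {dot H for @scalar_conj R s})
    (norm_dot : forall x : H, `|x| ^+ 2 = dot x x)
    (K : nat) (hK : K = 3%N \/ K = 4%N)
    (Lk : 'I_K -> set H) (Lk_closed : forall k, closed_subspace (Lk k)) :
  let L := \bigcap_k Lk k in
  let T := proj_product dot Lk in
  [<->
    (* (i) *)
    ~ closed (sum_sets (fun k => orthocomp dot (Lk k)));
    (* (ii) *)
    forall a : nat -> R, a @ \oo --> (0 : R) ->
      exists z : H, forall n : nat,
        `|iter n T z - orth_proj dot L z| >= of_real s (a n);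
    (* (iii) *)
    exists (Lt : 'I_K -> set H) (z0 : H) (k : nat -> 'I_K),
      [/\ forall j, closed_subspace (Lt j),
          forall j, Lt j `<=` Lk j `&` orthocomp dot L,
          forall j N, exists2 n, (N <= n)%N & k n = j
        & ~ cvgn (proj_iterates dot Lt k z0)]].
Proof.
move=> L T.
have K0 : (0 < K)%N by case: hK => ->.
have K1 : (1 < K)%N by case: hK => ->.
(* The cycle (i), (ii), (iii), (i), each implication passing through the failure of regularity. *)
tfae.
- move=> nclosed; apply: (not_regular_slow norm_dot Lk_closed) => reg.
  apply: nclosed; rewrite (regular_perp_sum norm_dot Lk_closed reg).
  by case: (orthocomp_closed norm_dot L).
- move=> hslow; apply: (not_regular_divergence norm_dot Lk_closed hK).
  exact: (slow_not_regular norm_dot Lk_closed).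
- move=> [Lt [z0 [k [cLt subLt kinf ndiv]]]] closed_sum; apply: ndiv.
  apply: (innate_regularity norm_dot Lk_closed K1 (four_letters hK) cLt subLt kinf).
  exact: (closed_perp_sum_regular norm_dot Lk_closed K0).
Qed.
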